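(* Let $n\ge 3$ be an integer, let $W_n$ be the wheel with central vertex $v_c$, let $J$ be a non-empty even subgraph of $W_n$, and let $I\in SI_5$. Let $G\in (W_n,J_I)$. Then $\Phi_c(G)\ge 5$ if and only if at least one of the following holds: (i) $I=\emptyset$; (ii) $I=(2,3)$; (iii) $I\subseteq (4,1)$, $n$ is odd, and $J$ has no $k$-connector for $k>1$; (iv) $I\subseteq (1,2)\cup(3,4)$ and either $n>3$ is odd and $J$ is the external cycle of $W_n$, or $n=3$ and $J$ is a $3$-cycle.
   Context: Graphs are finite and may have multiple edges. Circular flow number: for real $r\ge 2$, a circular nowhere-zero $r$-flow in a graph $G$ is an orientation of $G$ together with a real-valued flow (inflow equals outflow at every vertex) such that the value on each edge lies in $[1,r-1]$. The circular flow number $\Phi_c(G)$ is the infimum of the reals $r$ such that $G$ has a circular nowhere-zero $r$-flow ($+\infty$ if there is none). Intervals: $\mathbb{R}/5\mathbb{Z}$ is viewed as a circle of length $5$. For $a\neq b$ in $\mathbb{R}/5\mathbb{Z}$, $(a,b)$ denotes the open arc traversed clockwise (increasing direction) from $a$ to $b$, and $(x,x)=\mathbb{R}/5\mathbb{Z}\setminus\{x\}$; for instance $(4,1)$ is the open arc of length $2$ containing $0$. $I_5$ is the set of all $(a,b)$ with $a,b$ integers modulo $5$. A set $X\subseteq\mathbb{R}/5\mathbb{Z}$ is symmetric if $x\in X\iff -x\in X$. $SI_5$ is the family of all symmetric subsets of $\mathbb{R}/5\mathbb{Z}$ that are unions of (possibly no) elements of $I_5$; in particular $\emptyset\in SI_5$.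 Generalised edges: a generalised edge $G_{xy}$ is a graph $G$ with at least two vertices together with two distinct vertices $x,y$, its terminals. $G_{xy}^+$ is obtained from $G_{xy}$ by adding a new edge $e^+=xy$. The open $5$-capacity is $CP_5(G_{xy})=\{f(e^+): f \text{ is a modulo-}5\text{ flow in } G_{xy}^+ \text{ (for some orientation) with } f(e)\in(1,4) \text{ for every } e\in E(G)\}$, where a modulo-$5$ flow takes values in $\mathbb{R}/5\mathbb{Z}$ and satisfies conservation modulo $5$ at every vertex. It is always an element of $SI_5$. For $A\in SI_5$, an $A$-edge is a generalised edge with $CP_5=A$ (a single ordinary edge is a $(1,4)$-edge). Families: for a graph $H$ and a capacity function $\sigma:E(H)\to SI_5$, $H^\sigma$ is the family of all graphs obtained from $H$ by replacing every edge $uv$ by a $\sigma(uv)$-edge with terminals $u$ and $v$ (the replacing generalised edges being disjoint from each other except possibly at terminals). Wheels: $W_n$ has $n+1$ vertices and consists of a cycle of length $n$ (the external cycle) and a central vertex $v_c$ adjacent to every vertex of that cycle. An even subgraph is a subgraph in which all vertices have even degree; non-empty means it has at least one edge. $(W_n,J_I)$ denotes the family $W_n^\sigma$ where $\sigma(e)=I$ if $e\in E(J)$ and $\sigma(e)=(1,4)$ otherwise. Connectors: for an integer $m\ge 0$, an $m$-connector of $J$ is the subgraph of $W_n$ induced by all $m+1$ edges of a maximal path $P_{m+2}$ (on $m+2$ vertices) formed by edges of the external cycle that do not belong to $J$, together with all edges $uv_c$ not in $J$, where $u$ is a vertex of degree $2$ of $P_{m+2}$. *)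

(* Defs.v *)
From HB Require Import structures.
From mathcomp Require Import all_boot all_order all_algebra.
From mathcomp Require Import all_classical all_reals ereal.

Set Implicit Arguments.
Unset Strict Implicit.
Unset Printing Implicit Defensive.

Import Order.TTheory GRing.Theory Num.Theory.

Local Open Scope ring_scope.
Local Open Scope quotient_scope.

(* Parallel edges are allowed, loops are not. *)
Record mgraph := MGraph {
  vert : finType;
  edge : finType;
  ends : edge -> {set vert};
  card_ends : forall e, #|ends e| = 2%N }.

Record orientation (G : mgraph) := Orientation {
  tl : edge G -> vert G;
  hd : edge G -> vert G;
  endsE : forall e, ends e = [set tl e; hd e]%SET }.

Definition isomorphic (G H : mgraph) : Prop :=
  exists (phi : vert G -> vert H) (psi : edge G -> edge H),
    [/\ bijective phi, bijective psi
      & forall e, ends (psi e) = (phi @: ends e)%SET].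

Definition is_flow (V : zmodType) (G : mgraph) (o : orientation G)
    (f : edge G -> V) : Prop :=
  forall v, \sum_(e | hd o e == v) f e = \sum_(e | tl o e == v) f e.

Definition circular_nz_flow (R : realType) (r : R) (G : mgraph) : Prop :=
  exists (o : orientation G) (f : edge G -> R),
    is_flow o f /\ forall e, 1 <= f e <= r - 1.

(* The infimum of the empty set is [+oo]. *)
Definition Phi_c (R : realType) (G : mgraph) : \bar R :=
  ereal_inf [set r%:E | r in [set r : R | 2 <= r /\ circular_nz_flow r G]]%classic.

Definition fiveZ (R : realType) : {pred R} := fun x => x / 5 \is a Num.int.

Fact fiveZ_zmod_closed (R : realType) : zmod_closed (@fiveZ R).
Proof.
split=> [|x y]; rewrite /fiveZ !unfold_in ?mul0r ?mulrBl => *.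
  exact: rpred0.
exact: rpredB.
Qed.
HB.instance Definition _ (R : realType) :=
  GRing.isZmodClosed.Build R (@fiveZ R) (fiveZ_zmod_closed R).

Definition circ5 (R : realType) := Quotient.quot (@fiveZ R).

Definition pt (R : realType) (x : R) : circ5 R := \pi_(Quotient.quot (@fiveZ R)) x.

(* Lift [a] to [s] and let [t] be the first lift of [b] after [s]; as [t] may be
   [s + 5], [arc a a] is the complement of [a]. *)
Definition arc (R : realType) (a b : circ5 R) : set (circ5 R) :=
  [set z | exists s t u : R,
     [/\ pt s = a, pt t = b, s < t <= s + 5, s < u < t & z = pt u]]%classic.

Definition iarc (R : realType) (a b : int) : set (circ5 R) :=
  arc (pt a%:~R) (pt b%:~R).

Definition I5 (R : realType) : set (set (circ5 R)) :=
  [set A | exists a b : int, A = iarc a b]%classic.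

Definition symmetric5 (R : realType) (X : set (circ5 R)) : Prop :=
  forall x, X x <-> X (- x).

Definition SI5 (R : realType) : set (set (circ5 R)) :=
  [set X | symmetric5 X /\
     exists2 F, F `<=` @I5 R & X = \bigcup_(A in F) A]%classic.

Record gedge := GEdge {
  gegraph :> mgraph;
  term1 : vert gegraph;
  term2 : vert gegraph;
  term_neq : term1 != term2 }.

Section GeneralisedEdge.
Variable K : gedge.

Definition plus_ends (e : option (edge K)) : {set vert K} :=
  if e is Some e' then ends e' else [set term1 K; term2 K]%SET.

Fact card_plus_ends e : #|plus_ends e| = 2%N.
Proof. by case: e => [e|] /=; rewrite ?card_ends // cards2 term_neq. Qed.

(* The added edge is [None]. *)
Definition gplus : mgraph := MGraph card_plus_ends.

Definition CP5 (R : realType) : set (circ5 R) :=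
  [set z | exists (o : orientation gplus) (f : edge gplus -> circ5 R),
     [/\ is_flow o f, forall e : edge K, iarc 1 4 (f (Some e))
       & z = f None]]%classic.

End GeneralisedEdge.
Arguments CP5 : clear implicits.

(* Replacing every edge [e] of [H] by [K e], with [term1 (K e)] and
   [term2 (K e)] identified with [tl o e] and [hd o e] respectively. *)
Section Replacement.
Variables (H : mgraph) (o : orientation H) (K : edge H -> gedge).

Definition inner (e : edge H) : finType :=
  {v : vert (K e) | (v != term1 (K e)) && (v != term2 (K e))}.

Definition rvert : finType := (vert H + {e : edge H & inner e})%type.

Definition place (e : edge H) (v : vert (K e)) : rvert :=
  if insub v is Some w then inr (Tagged inner (w : inner e))
  else inl (if v == term1 (K e) then tl o e else hd o e).

Fact tl_neq_hd e : tl o e != hd o e.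
Proof. by have := card_ends e; rewrite (endsE o) cards2; case: eqP. Qed.

Fact place_inj e : injective (@place e).
Proof.
move=> v w; rewrite /place.
case: insubP => [v' _ ev|nv]; case: insubP => [w' _ ew|nw] //.
  by move=> E; rewrite -ev -ew (eq_from_Tagged (@inr_inj _ _ _ _ E)).
move=> E; have {E} := @inl_inj _ _ _ _ E; move: nv nw (tl_neq_hd e); rewrite !negb_and !negbK.
case: (v =P term1 _) => [->|_] /=; case: (w =P term1 _) => [->|_] //=.
- by move=> _ _ /eqP N /N.
- by move=> _ _ /eqP N /esym/N.
by move=> /eqP-> /eqP->.
Qed.

Definition rends (a : {e : edge H & edge (K e)}) : {set rvert} :=
  (@place (tag a) @: ends (tagged a))%SET.

Fact card_rends a : #|rends a| = 2%N.
Proof. by rewrite card_imset ?card_ends //; apply: place_inj. Qed.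

Definition replace_edges : mgraph := MGraph card_rends.

End Replacement.

(* G belongs to H^sigma, a family taken up to isomorphism. *)
Definition family (R : realType) (H : mgraph) (sigma : edge H -> set (circ5 R))
    (G : mgraph) : Prop :=
  exists (o : orientation H) (K : edge H -> gedge),
    (forall e, CP5 (K e) R = sigma e) /\ isomorphic G (replace_edges o K).

(* Subgraphs are given by their sets of edges. *)
Section Subgraphs.
Variable G : mgraph.
Implicit Types (v : vert G) (F P : {set edge G}).

Definition deg F v : nat := #|[set e in F | v \in ends e]%SET|.

Definition even_subgraph F : Prop := forall v, ~~ odd (deg F v).

Fixpoint walk v (p : seq (edge G * vert G)) : bool :=
  if p is (e, w) :: p' then (ends e == [set v; w]%SET) && walk w p' else true.

(* [P] is the edge set of a path with [k] edges. *)
Definition is_path (k : nat) P : Prop :=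
  exists v (p : seq (edge G * vert G)),
    [/\ walk v p, uniq (v :: unzip2 p), size p = k
      & P = [set e in unzip1 p]%SET].

Definition maximal_path F (k : nat) P : Prop :=
  [/\ is_path k P, P \subset F
    & forall k' P', is_path k' P' -> P' \subset F -> P \subset P' -> P' = P].

Definition is_3cycle F : Prop :=
  exists (a b c : vert G) (e1 e2 e3 : edge G),
    [/\ uniq [:: a; b; c], ends e1 = [set a; b]%SET, ends e2 = [set b; c]%SET,
        ends e3 = [set c; a]%SET & F = [set e1; e2; e3]%SET].

End Subgraphs.

Section Wheel.
Variables (n : nat) (hn : (3 <= n)%N).

(* [None] is the centre, [inl i] the edge of the external cycle from [i] to its
   cyclic successor, and [inr i] the edge from [i] to the centre. *)
Definition wheel_ends (e : 'I_n + 'I_n) : {set option 'I_n} :=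
  match e with
  | inl i => [set Some i; Some (ordS i)]%SET
  | inr i => [set Some i; None]%SET
  end.

Fact card_wheel_ends e : #|wheel_ends e| = 2%N.
Proof.
case: e => i /=; rewrite cards2 //=; case: eqP => // -[/(congr1 val) /=].
have := ltn_ord i; rewrite leq_eqVlt => /orP[/eqP E|lt_in].
  by rewrite E modnn => i0; move: hn; rewrite -E i0.
by rewrite modn_small // => /n_Sn.
Qed.

Definition wheel : mgraph := MGraph card_wheel_ends.

Definition external_cycle : {set edge wheel} := [set inl i | i : 'I_n]%SET.

Definition wheel_family (R : realType) (J : {set edge wheel})
    (I : set (circ5 R)) : mgraph -> Prop :=
  @family R wheel (fun e => if e \in J then I else iarc 1 4).

Definition connector (J : {set edge wheel}) (m : nat) (C : {set edge wheel}) :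
    Prop :=
  exists P : {set edge wheel},
    maximal_path (external_cycle :\: J)%SET m.+1 P /\
    C = (P :|: [set inr i | i : 'I_n &
                 (inr i \notin J) && (deg P (Some i : vert wheel) == 2%N)])%SET.

End Wheel.

(* Main.v *)
Require Import Defs.
From mathcomp Require Import all_boot all_order all_algebra.
From mathcomp Require Import all_classical all_reals ereal.
From mathcomp Require Import ring lra zify.

(** A circular nowhere-zero r-flow with r < 5, multiplied by a factor slightly
    above 1, has all its values in the open interval (1,4).  Conversely, a
    modulo-5 flow with values in (1,4) lifts to real numbers, becomes a real
    flow with values in (1,4) after edges are reversed along directed paths (as
    in Tutte's theorem on modular flows), and can then be scaled down.  So
    Phi_c(G) < 5 says that G has a modulo-5 flow with values in (1,4)
    ([Phi_cP]).  Cut at the terminals of the generalised edges, such a flow is a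
    modulo-5 flow of the wheel whose value on each edge lies in the capacity of
    this edge ([replace_modflow]).

    A flow in the wheel is determined by its values x_i on the external cycle,
    because the spoke between the external edges i and i+1 carries the
    difference x_(i+1) - x_i.  As J is even, this spoke lies in J exactly when
    one of the two external edges does and the other does not.  What remains is
    a question on cyclic sequences: write S for an external edge in J and N for
    one outside J; find x_i in I at each S and in (1,4) at each N, such that
    consecutive values differ by an element of I between an S and an N, and by
    an element of (1,4) otherwise ([wheel_modflow]).

    A symmetric union of integer arcs other than the empty set and (2,3) is
    contained in (4,1), or in the union of (1,2) and (3,4), or else contains two
    of the three sets of points at distance from 0 in (0,1), in (1,2) or above 2
    ([SI5_cases]).
    - With two of these sets, give consecutive values alternating signs, and put
      at one S a value that is compatible with both signs of its neighbours:
      then the sequence closes up for every n ([solvable_two]).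
    - Inside (4,1), or inside the union of (1,2) and (3,4), the sign of x_i is
      forced to alternate in a suitable sense, which needs n even, unless
      the pattern of S and N leaves room to break the rule once.  For (4,1) this
      takes three consecutive N ([unsolvable_iarc41], [solvable_01_odd]), that
      is, a k-connector with k > 1 ([connector_run], [run_connector]).  For the
      other set any N will do when n > 3, and the pattern S N S when n = 3
      ([unsolvable_full], [unsolvable_triangle], [solvable_12_odd]). *)

Set Implicit Arguments.
Unset Strict Implicit.
Unset Printing Implicit Defensive.

Import Order.TTheory GRing.Theory Num.Theory.

Local Open Scope ring_scope.
Local Open Scope quotient_scope.

(** * The circle of length 5 *)

Lemma pt0 (R : realType) : pt (0 : R) = 0.
Proof. by rewrite /pt raddf0. Qed.

Lemma ptN (R : realType) (u : R) : pt (- u) = - pt u.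
Proof. by rewrite /pt raddfN. Qed.

Lemma ptB (R : realType) (u v : R) : pt (u - v) = pt u - pt v.
Proof. by rewrite /pt raddfB. Qed.

Lemma pt_sum (R : realType) (E : finType) (P : pred E) (f : E -> R) :
  pt (\sum_(e | P e) f e) = \sum_(e | P e) pt (f e).
Proof. by rewrite /pt raddf_sum. Qed.

Lemma pt_surj (R : realType) (z : circ5 R) : exists u, z = pt u.
Proof. by exists (repr z); rewrite /pt reprK. Qed.

Lemma ptP (R : realType) (u v : R) :
  pt u = pt v <-> exists k : int, u = v + 5 * k%:~R.
Proof.
have E : pt u = pt v <-> (u - v) / 5 \is a Num.int.
  rewrite -[(u - v) / 5 \is a _]/(u - v \in @fiveZ R) Quotient.idealrBE.
  by split=> /eqP.
rewrite E; split=> [/intrP[k Ek]|[k ->]].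
  by exists k; rewrite -Ek; field.
by apply/intrP; exists k; field.
Qed.

Lemma pt_shift (R : realType) (u : R) (k : int) : pt (u + 5 * k%:~R) = pt u.
Proof. by apply/ptP; exists k. Qed.

Lemma pt_int_eq0 (R : realType) (u : R) :
  pt u = 0 -> exists k : int, u = 5 * k%:~R.
Proof. by rewrite -(pt0 R) => /ptP[k ->]; exists k; rewrite add0r. Qed.

Lemma iarcP (R : realType) (a b : int) (z : circ5 R) : a < b <= a + 5 ->
  iarc a b z <-> exists2 u : R, a%:~R < u < b%:~R & z = pt u.
Proof.
move=> /andP[ab ba]; split=> [[s [t [u [Es Et st su ->]]]]|[u au ->]]; last first.
  by exists a%:~R, b%:~R, u; split=> //; rewrite ltr_int ab -[5]/(5%:~R) -intrD ler_int.
move: Es Et => /ptP[j Ej] /ptP[k Ek].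
have jk : j = k.
  move: st; rewrite Ej Ek -[5]/(5%:~R) -!intrM -!intrD ltr_int ler_int; lia.
exists (u + 5 * (- j)%:~R); last by rewrite pt_shift.
by move: su; rewrite Ej Ek jk intrN; lra.
Qed.

Lemma symmetric_iarc14 (R : realType) : symmetric5 (iarc 1 4 : set (circ5 R)).
Proof.
suff H (z : circ5 R) : iarc 1 4 z -> iarc 1 4 (- z) by move=> z; split=> [/H|/H]; rewrite ?opprK.
move=> /iarcP -/(_ isT)[u u1 ->]; apply/iarcP => //; exists (5 - u); first by lra.
by rewrite -ptN; apply/ptP; exists (-1); rewrite intrN; lra.
Qed.

(** Only the lifts u, u + 5 and u - 5 can meet an interval inside [-1,4]; in this
    form membership in an arc is a matter of linear arithmetic on differences of
    representatives. *)
Lemma iarc_real (R : realType) (a b : int) (u : R) :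
    -1 <= a -> a < b -> b <= 4 -> -6 < u < 6 ->
  iarc a b (pt u) <-> [\/ a%:~R < u < b%:~R, a%:~R < u + 5 < b%:~R
                        | a%:~R < u - 5 < b%:~R].
Proof.
move=> a1 ab b4 u6; have ab5 : a < b <= a + 5 by lia.
split=> [/(iarcP _ ab5)[v v1 /ptP[k Ek]]|].
  have a1' : (-1 : R) <= a%:~R by rewrite -[-1]/((-1)%:~R) ler_int.
  have b4' : (b%:~R : R) <= 4 by rewrite -[4]/(4%:~R) ler_int.
  have k1 : k < 2 by rewrite -(ltr_int R); lra.
  have k2 : -2 < k by rewrite -(ltr_int R) intrN; lra.
  have [k0|[k0|k0]] : k = 0 \/ k = 1 \/ k = -1 by lia.
  - by apply: Or31; rewrite Ek k0; lra.
  - by apply: Or33; rewrite Ek k0; lra.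
  - by apply: Or32; rewrite Ek k0 intrN; lra.
case=> v1; apply/(iarcP _ ab5).
- by exists u.
- by exists (u + 5) => //; apply/ptP; exists (-1); rewrite intrN; lra.
- by exists (u - 5) => //; apply/ptP; exists 1; lra.
Qed.

Lemma iarc41E (R : realType) : iarc 4 1 = iarc (-1)%R 1 :> set (circ5 R).
Proof.
rewrite /iarc; have -> // : pt (Posz 4)%:~R = pt (-1)%:~R :> circ5 R.
by apply/ptP; exists 1; rewrite intrN; lra.
Qed.

Lemma iarc14_real (R : realType) (u : R) : -6 < u < 6 ->
  iarc 1 4 (pt u) <-> (1 < u < 4) || (-4 < u < -1).
Proof.
move=> u6; rewrite iarc_real //; split=> [[]|/orP[]] H; try lra.
  by apply: Or31; lra.
by apply: Or32; lra.
Qed.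

Lemma iarc41_real (R : realType) (u : R) : -6 < u < 6 ->
  iarc 4 1 (pt u) <-> [|| -1 < u < 1, u < -4 | 4 < u].
Proof.
move=> u6; rewrite iarc41E iarc_real // intrN; split=> [[]|/or3P[]] H; try lra.
- by apply: Or31; lra.
- by apply: Or32; lra.
- by apply: Or33; lra.
Qed.

(** No end of an arc with integer ends lies strictly between k and k + 1, so such
    an arc through a point of the closed interval [k,k+1] contains the open one. *)
Lemma SI5_interval (R : realType) (I : set (circ5 R)) (k : int) (u v : R) :
    SI5 I -> k%:~R <= u <= k%:~R + 1 -> I (pt u) ->
  k%:~R < v < k%:~R + 1 -> I (pt v).
Proof.
move=> [_ [F FI ->]] uk [X FX Xu] vk; exists X => //.
have [a [b EX]] := FI _ FX; move: Xu; rewrite {}EX => -[s [t [w [Es Et st wst]]]].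
move=> /ptP[l El].
have [i Ei] : exists i : int, s = i%:~R.
  by have /ptP[j ->] := Es; exists (a + 5 * j); rewrite intrD intrM.
have [j Ej] : exists j : int, t = j%:~R.
  by have /ptP[m ->] := Et; exists (b + 5 * m); rewrite intrD intrM.
have l5 : 5 * l%:~R = (5 * l)%:~R :> R by rewrite intrM.
have ik : i + 5 * l < k + 1.
  by rewrite -(ltr_int R) !intrD -l5 -Ei; lra.
have kj : k < j + 5 * l.
  by rewrite -(ltr_int R) !intrD -l5 -Ej; lra.
have {}ik : (i + 5 * l)%:~R <= k%:~R :> R by rewrite ler_int; lia.
have {}kj : (k + 1)%:~R <= (j + 5 * l)%:~R :> R by rewrite ler_int; lia.
move: ik kj; rewrite !intrD -l5 -Ei -Ej => ik kj.
exists (s + 5 * l%:~R), (t + 5 * l%:~R), v; rewrite !pt_shift.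
by split=> //; lra.
Qed.

Section Symmetric.
Variables (R : realType) (I : set (circ5 R)).
Hypothesis hI : SI5 I.

Lemma SI5N (u : R) : I (pt u) -> I (pt (- u)).
Proof. by rewrite ptN => /(proj1 hI). Qed.

Lemma SI5_01 (u : R) : I (pt (1 / 2)) -> (0 < u < 1) || (-1 < u < 0) -> I (pt u).
Proof.
move=> I1 /orP[] u1.
  by apply: (SI5_interval (k := 0) (u := 1/2)) => //; lra.
by rewrite -[u]opprK; apply/SI5N/(SI5_interval (k := 0) (u := 1/2)) => //; lra.
Qed.

Lemma SI5_12 (u : R) : I (pt (3 / 2)) ->
  [|| 1 < u < 2, -2 < u < -1, 3 < u < 4 | -4 < u < -3] -> I (pt u).
Proof.
move=> I1 /or4P[] u1.
- by apply: (SI5_interval (k := 1) (u := 3/2)) => //; lra.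
- by rewrite -[u]opprK; apply/SI5N/(SI5_interval (k := 1) (u := 3/2)) => //; lra.
- rewrite -(pt_shift u (-1)) -[_ + _]opprK.
  by apply/SI5N/(SI5_interval (k := 1) (u := 3/2)) => //; rewrite ?intrN; lra.
- rewrite -(pt_shift u 1).
  by apply/(SI5_interval (k := 1) (u := 3/2)) => //; lra.
Qed.

Lemma SI5_23 (u : R) : I (pt (5 / 2)) -> (2 < u < 3) || (-3 < u < -2) -> I (pt u).
Proof.
move=> I1 /orP[] u1.
  by apply: (SI5_interval (k := 2) (u := 5/2)) => //; lra.
by rewrite -[u]opprK; apply/SI5N/(SI5_interval (k := 2) (u := 5/2)) => //; lra.
Qed.

Lemma SI5_not_01 (u : R) : ~ I (pt (1 / 2)) -> -1 <= u <= 1 -> ~ I (pt u).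
Proof.
move=> nI u1 Iu; apply: nI; have [u0|u0] := leP 0 u.
  by apply: (SI5_interval (k := 0) (u := u)) => //; lra.
have /SI5N Iv := Iu.
by apply: (SI5_interval (k := 0) (u := - u)) => //; lra.
Qed.

Lemma SI5_not_12 (u : R) : ~ I (pt (3 / 2)) ->
  (1 <= u <= 2) || (3 <= u <= 4) -> ~ I (pt u).
Proof.
move=> nI u1 Iu; apply: nI; case/orP: u1 => u1.
  by apply: (SI5_interval (k := 1) (u := u)) => //; lra.
have /SI5N := Iu; rewrite -(pt_shift _ 1) => Iv.
by apply: (SI5_interval (k := 1) hI _ Iv); lra.
Qed.

Lemma SI5_not_23 (u : R) : ~ I (pt (5 / 2)) -> 2 <= u <= 3 -> ~ I (pt u).
Proof.
by move=> nI u1 Iu; apply: nI; apply: (SI5_interval (k := 2) (u := u)) => //; lra.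
Qed.

End Symmetric.

(** This choice of representatives restricts to an actual interval on both arcs
    that matter, (4,1) and (1,4). *)
Lemma pt_repr (R : realType) (z : circ5 R) : exists2 u : R, -1 <= u < 4 & z = pt u.
Proof.
have [u ->] := pt_surj z; set k := Num.floor ((u + 1) / 5).
exists (u + 5 * (- k)%:~R); last by rewrite pt_shift.
have := floor_le_tmp ((u + 1) / 5); have := floorD1_gt ((u + 1) / 5).
by rewrite -/k intrN intrD; lra.
Qed.

Lemma iarc_pt (R : realType) (a b : int) (u : R) : a < b <= a + 5 ->
  a%:~R < u < b%:~R -> iarc a b (pt u).
Proof. by move=> ab u1; apply/(iarcP _ ab); exists u. Qed.


(** By [SI5_interval] the points 1/2, 3/2 and 5/2 decide which of the three kinds of
    unit intervals I contains; if I misses one of these points, it also misses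
    the closed interval around it, hence the integer ends. *)
Lemma SI5_cases (R : realType) (I : set (circ5 R)) (hI : SI5 I) :
  [\/ I = set0 \/ I = iarc 2 3,
      [/\ (I `<=` iarc 4 1)%classic & I (pt (1 / 2))],
      [/\ (I `<=` iarc 1 2 `|` iarc 3 4)%classic & I (pt (3 / 2))]
    | [\/ I (pt (1 / 2)) /\ I (pt (3 / 2)), I (pt (1 / 2)) /\ I (pt (5 / 2))
        | I (pt (3 / 2)) /\ I (pt (5 / 2))]].
Proof.
have n01 := SI5_not_01 hI; have n12 := SI5_not_12 hI; have n23 := SI5_not_23 hI.
have [A|/n01 {}n01] := pselect (I (pt (1/2)));
have [B|/n12 {}n12] := pselect (I (pt (3/2)));
have [C|/n23 {}n23] := pselect (I (pt (5/2))).
- by apply: Or44; apply: Or31.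
- by apply: Or44; apply: Or31.
- by apply: Or44; apply: Or32.
- apply: Or42; split=> // z; have [u u1 ->] := pt_repr z => Iu.
  apply/iarc41_real; first lra.
  have [/n12//|] := boolP ((1 <= u <= 2) || (3 <= u <= 4)).
  have [/n23//|] := boolP (2 <= u <= 3).
  move=> h1 h2.
  suff : -1 < u < 1 by move=> ->.
  have : u <> -1.
    move=> E; apply: (n12 4); first by lra.
    by move: Iu; rewrite E -(pt_shift _ 1); have -> : -1 + 5 * 1%:~R = 4 :> R by lra.
  by move=> /eqP; lra.
- by apply: Or44; apply: Or33.
- apply: Or43; split=> // z; have [u u1 ->] := pt_repr z => Iu.
  have [/n01//|h1] := boolP (-1 <= u <= 1).
  have [/n23//|h2] := boolP (2 <= u <= 3).
  have [u2|u2] := ltP u 2; [left|right]; apply: iarc_pt => //; lra.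
- apply: Or41; right; apply/seteqP; split=> z.
    have [u u1 ->] := pt_repr z => Iu.
    have [/n01//|h1] := boolP (-1 <= u <= 1).
    have [/n12//|h2] := boolP ((1 <= u <= 2) || (3 <= u <= 4)).
    by apply: iarc_pt => //; lra.
  move=> /iarcP -/(_ isT) [u u1 ->]; apply: (SI5_23 hI C); lra.
- apply: Or41; left; apply/seteqP; split=> z //.
  have [u u1 ->] := pt_repr z => Iu.
  have [/n01//|h1] := boolP (-1 <= u <= 1).
  have [/n12//|h2] := boolP ((1 <= u <= 2) || (3 <= u <= 4)).
  have [/n23//|h3] := boolP (2 <= u <= 3).
  lra.
Qed.

(** * Flows without orientations *)

Lemma orientation_exists (G : mgraph) : exists o : orientation G, True.
Proof.
have /all_sig[st stP] e : {st : vert G * vert G | ends e = [set st.1; st.2]%SET}.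
  have /eqP/cards2P/boolp.cid[x /boolp.cid[y [_ E]]] := card_ends e.
  by exists (x, y).
by exists (@Orientation G (fun e => (st e).1) (fun e => (st e).2) stP).
Qed.

Section Orientation.
Variables (G : mgraph) (o : orientation G).

Lemma hd_neq_tl e : hd o e != tl o e.
Proof. by rewrite eq_sym tl_neq_hd. Qed.

Lemma in_ends e v : (v \in ends e) = (v == tl o e) || (v == hd o e).
Proof. by rewrite (endsE o) !inE. Qed.

End Orientation.

(** A flow with the orientation divided out: [phi e v] is the amount that [e] brings
    into [v].  Isomorphisms and the gluing of graphs act on such functions without
    any choice of signs. *)
Definition balanced (V : zmodType) (G : mgraph) (phi : edge G -> vert G -> V) : Prop :=
  [/\ forall e v, v \notin ends e -> phi e v = 0, forall e, \sum_v phi e v = 0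
    & forall v, \sum_e phi e v = 0].

Definition inflow (V : zmodType) (G : mgraph) (o : orientation G) (f : edge G -> V) e v : V :=
  (if hd o e == v then f e else 0) - (if tl o e == v then f e else 0).

Lemma inflow_sum (V : zmodType) (G : mgraph) (o : orientation G) (f : edge G -> V) v :
  \sum_e inflow o f e v = \sum_(e | hd o e == v) f e - \sum_(e | tl o e == v) f e.
Proof. by rewrite sumrB -!big_mkcond. Qed.

Lemma inflow_hd (V : zmodType) (G : mgraph) (o : orientation G) (f : edge G -> V) e :
  inflow o f e (hd o e) = f e.
Proof. by rewrite /inflow eqxx (negbTE (tl_neq_hd o e)) subr0. Qed.

Lemma inflow_tl (V : zmodType) (G : mgraph) (o : orientation G) (f : edge G -> V) e :
  inflow o f e (tl o e) = - f e.
Proof. by rewrite /inflow eqxx (negbTE (hd_neq_tl o e)) sub0r. Qed.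

Lemma is_flow_balanced (V : zmodType) (G : mgraph) (o : orientation G) (f : edge G -> V) :
  is_flow o f -> balanced (inflow o f).
Proof.
move=> fl; split=> [e v|e|v].
- by rewrite (in_ends o) /inflow ![v == _]eq_sym => /norP[/negbTE-> /negbTE->]; rewrite subr0.
- rewrite sumrB -!big_mkcond /= (big_pred1 (hd o e)); last by move=> v; apply: eq_sym.
  by rewrite (big_pred1 (tl o e)) ?subrr // => v; apply: eq_sym.
- by rewrite inflow_sum fl subrr.
Qed.

Lemma balanced_tl (V : zmodType) (G : mgraph) (o : orientation G) (phi : edge G -> vert G -> V) e :
  balanced phi -> phi e (tl o e) = - phi e (hd o e).
Proof.
move=> [off sum0 _]; apply/eqP; rewrite -addr_eq0 -(sum0 e).
rewrite (bigD1 (tl o e)) //= (bigD1 (hd o e)) ?hd_neq_tl //= big1 ?addr0 // => v /andP[vt vh].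
by rewrite off // (in_ends o) negb_or vt.
Qed.

Lemma balanced_inflow (V : zmodType) (G : mgraph) (o : orientation G) (phi : edge G -> vert G -> V) e v :
  balanced phi -> phi e v = inflow o (fun e => phi e (hd o e)) e v.
Proof.
move=> phi_bal; rewrite /inflow; have [<-|hv] := eqVneq (hd o e) v.
  by rewrite (negbTE (tl_neq_hd o e)) subr0.
have [<-|tv] := eqVneq (tl o e) v; first by rewrite sub0r (balanced_tl o).
by rewrite subr0; case: phi_bal => -> //; rewrite (in_ends o) negb_or ![v == _]eq_sym tv.
Qed.

Lemma balanced_is_flow (V : zmodType) (G : mgraph) (o : orientation G) (phi : edge G -> vert G -> V) :
  balanced phi -> is_flow o (fun e => phi e (hd o e)).
Proof.
move=> phi_bal v; apply/eqP; rewrite -subr_eq0 -inflow_sum.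
under eq_bigr do rewrite -balanced_inflow //.
by case: phi_bal => _ _ ->.
Qed.

(** Meant for symmetric [c]: the values of [phi e] at the two ends of [e] are opposite. *)
Definition modflow (R : realType) (G : mgraph) (c : edge G -> set (circ5 R)) : Prop :=
  exists2 phi, balanced phi & forall e v, v \in ends e -> c e (phi e v).

Lemma modflow_orient (R : realType) (G : mgraph) (o : orientation G) (c : edge G -> set (circ5 R)) :
  (forall e, symmetric5 (c e)) ->
  modflow c <-> exists2 f, is_flow o f & forall e, c e (f e).
Proof.
move=> csym; split=> [[phi phi_bal phi_c]|[f f_flow f_c]].
  exists (fun e => phi e (hd o e)); first exact: balanced_is_flow.
  by move=> e; apply: phi_c; rewrite (in_ends o) eqxx orbT.
exists (inflow o f); first exact: is_flow_balanced.
move=> e v; rewrite (in_ends o) => /orP[] /eqP->; first by rewrite inflow_tl; apply/csym; rewrite opprK.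
by rewrite inflow_hd.
Qed.

Lemma isomorphic_modflow (R : realType) (G H : mgraph) (X : set (circ5 R)) :
  isomorphic G H -> @modflow R G (fun=> X) <-> @modflow R H (fun=> X).
Proof.
move=> [p [q [[p' pK p'K] [q' qK q'K] pq]]].
have mem_pq e v : (p v \in ends (q e)) = (v \in ends e).
  by rewrite pq mem_imset //; apply: can_inj pK.
split=> -[phi [off sume sumv] phi_X].
  exists (fun e v => phi (q' e) (p' v)).
    split=> [e v|e|v].
    - by rewrite -{1}[e]q'K -{1}[v]p'K mem_pq; apply: off.
    - rewrite (reindex p) /=; last by exists p' => x _.
      under eq_bigr do rewrite pK.
      exact: sume.
    - rewrite (reindex q) /=; last by exists q' => x _.
      under eq_bigr do rewrite qK.
      exact: sumv.
  by move=> e v; rewrite -{1}[e]q'K -{1}[v]p'K mem_pq; apply: phi_X.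
exists (fun e v => phi (q e) (p v)).
  split=> [e v|e|v].
  - by rewrite -mem_pq; apply: off.
  - by have := sume (q e); rewrite (reindex p) //=; exists p' => x _.
  - by have := sumv (p v); rewrite (reindex q) //=; exists q' => x _.
by move=> e v; rewrite -mem_pq; apply: phi_X.
Qed.

(** * Circular flow number and modulo-5 flows *)

Section Reversal.
Variables (R : realType) (G : mgraph).
Implicit Types (o : orientation G) (g : edge G -> R) (X : {set edge G}).

Fact reverse_ends o X e :
  ends e = [set (if e \in X then hd o e else tl o e); (if e \in X then tl o e else hd o e)]%SET.
Proof. by rewrite (endsE o); case: ifP => // _; rewrite finset.setUC. Qed.

Definition reverse o X : orientation G := Orientation (reverse_ends o X).

Definition complement g X e : R := if e \in X then 5 - g e else g e.

(** Replacing g by 5 - g on a reversed edge changes nothing modulo 5, but moves 5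
    units of excess from the head of the edge to its tail. *)
Lemma reverse_inflow o g X e v :
  inflow (reverse o X) (complement g X) e v =
  inflow o g e v + 5 * (if e \in X then (tl o e == v)%:R - (hd o e == v)%:R else 0).
Proof.
rewrite /inflow /reverse /complement /=; case: (e \in X); last by rewrite mulr0 addr0.
by case: eqP => _; case: eqP => _ /=; lra.
Qed.

Definition arrow o : rel (vert G) := [rel x y | [exists e, (tl o e == x) && (hd o e == y)]].

(** Reversing a directed path moves excess from its last vertex to its first one
    and cancels inside.  Tails of the chosen edges are tracked so that in the
    induction the first edge is seen to be new. *)
Lemma path_edges o u p : path (arrow o) u p -> uniq (u :: p) ->
  exists2 X : {set edge G}, (forall e, e \in X -> tl o e \in u :: p)
  & forall v, \sum_e (if e \in X then (tl o e == v)%:R - (hd o e == v)%:R else 0)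
              = (u == v)%:R - (last u p == v)%:R :> int.
Proof.
elim: p u => [|w p IH] u /=.
  move=> _ _; exists finset.set0 => [e|v]; first by rewrite inE.
  by rewrite big1 ?subrr // => e _; rewrite inE.
move=> /andP[/existsP[e0 /andP[/eqP te /eqP he]] wp] /andP[u_notin uniq_wp].
have [X X_tl X_sum] := IH w wp uniq_wp.
have e0X : e0 \notin X by apply/negP => /X_tl; rewrite te (negbTE u_notin).
exists (e0 |: X)%SET => [e|v].
  by rewrite !inE => /orP[/eqP->|/X_tl]; rewrite ?te ?eqxx // inE => ->; rewrite orbT.
rewrite (bigD1 e0) //= !inE eqxx /= te he.
have := X_sum v; rewrite (bigD1 e0) //= (negbTE e0X) add0r => X_sum'.
rewrite [X in _ + X](_ : _ = (w == v)%:R - (last w p == v)%:R); first by lia.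
by rewrite -X_sum'; apply: eq_bigr => e /negbTE ne; rewrite !inE ne.
Qed.

Lemma inflow_set_sum o g (U : {set vert G}) :
  \sum_(v in U) \sum_e inflow o g e v =
  \sum_e ((if hd o e \in U then g e else 0) - (if tl o e \in U then g e else 0)).
Proof.
have pick w e : \sum_(v in U) (if w == v then g e else 0) = if w \in U then g e else 0.
  rewrite -big_mkcondr /=; case: ifP => wU.
    rewrite (big_pred1 w) // => v /=; rewrite [v == w]eq_sym.
    by case: (w =P v) => [<-|]; rewrite ?wU ?andbF.
  by rewrite big1 // => v /andP[vU /eqP E]; rewrite E vU in wU.
by rewrite exchange_big /=; apply: eq_bigr => e _; rewrite sumrB !pick.
Qed.

(** Tutte's argument, by induction on the total absolute excess.  Let v have
    positive excess.  If a vertex of negative excess reaches v along a directed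
    path, reversing this path decreases the total.  Otherwise the set U of vertices
    that reach v has positive total excess, although no edge enters U. *)
Lemma real_flow_of_mod5 o g (k : vert G -> int) :
    (forall e, 1 < g e < 4) -> (forall v, \sum_e inflow o g e v = 5 * (k v)%:~R) ->
  exists o' g', is_flow o' g' /\ forall e, 1 < g' e < 4.
Proof.
have [N] := ubnP (\sum_v `|k v|%N)%N.
elim: N o g k => // N IH o g k; rewrite ltnS => kN g14 kE.
have k_sum0 : \sum_v k v = 0.
  have : \sum_(v in finset.setT) \sum_e inflow o g e v = 0.
    by rewrite inflow_set_sum big1 // => e _; rewrite !inE subrr.
  under eq_bigr do rewrite kE.
  rewrite -mulr_sumr -rmorph_sum /= => /eqP; rewrite mulf_eq0 intr_eq0 pnatr_eq0 /= => /eqP E.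
  by rewrite -[RHS]E; apply: eq_bigl => v; rewrite inE.
have [/existsP[v kv]|/existsPn k_le0] := boolP [exists v, 0 < k v]; last first.
  exists o, g; split=> // v; apply/eqP; rewrite -subr_eq0 -inflow_sum kE.
  have : \sum_v - k v == 0 by rewrite sumrN k_sum0 oppr0.
  rewrite psumr_eq0 => [/allP /(_ v)|w _]; last by rewrite oppr_ge0 leNgt k_le0.
  by rewrite mem_index_enum oppr_eq0 /= => /(_ isT) /eqP->; rewrite mulr0.
have [/existsP[u /andP[uv ku]]|/existsPn no_neg] :=
    boolP [exists u, connect (arrow o) u v && (k u < 0)].
  have {uv} [p [up Ev uniq_up]] : exists p, [/\ path (arrow o) u p, v = last u p & uniq (u :: p)].
    by have /connectP[p up ->] := uv; case/shortenP: up => p' up' uniq_up _; exists p'.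
  have [X _ X_sum] := path_edges up uniq_up.
  have uv : u != v by apply: contraTneq ku => ->; rewrite -leNgt ltW.
  apply: (IH (reverse o X) (complement g X) (fun w => k w + ((u == w)%:R - (v == w)%:R))).
  - apply: leq_trans kN; rewrite (bigD1 v) //= (bigD1 u) //= [X in (_ < X)%N](bigD1 v) //=.
    rewrite [X in (_ < _ + X)%N](bigD1 u) //= eqxx (negbTE uv) eq_sym (negbTE uv) eqxx.
    rewrite !addnA [X in (_ + X < _)%N](_ : _ = \sum_(i | (i != v) && (i != u)) `|k i|%N)%N.
      by rewrite ltn_add2r; lia.
    apply: eq_bigr => w /andP[/negbTE wv /negbTE wu].
    by rewrite eq_sym wu eq_sym wv subrr addr0.
  - by move=> e; rewrite /complement; case: ifP => _; have := g14 e; lra.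
  - move=> w; under eq_bigr do rewrite reverse_inflow.
    rewrite big_split /= kE -mulr_sumr intrD mulrDr; congr (_ + 5 * _).
    rewrite Ev -X_sum rmorph_sum /=; apply: eq_bigr => e _.
    by case: ifP => _; rewrite ?intrB //; case: eqP; case: eqP.
pose U := [set u | connect (arrow o) u v]%SET.
have U_pos : 0 < \sum_(u in U) \sum_e inflow o g e u.
  under eq_bigr do rewrite kE.
  rewrite (bigD1 v) ?inE ?connect0 //= ltr_wpDr ?mulr_gt0 ?ltr0z //.
  apply: sumr_ge0 => u /andP[]; rewrite inE => uv _.
  by have := no_neg u; rewrite uv /= -leNgt => ku; rewrite mulr_ge0 ?ler0z.
have : \sum_(u in U) \sum_e inflow o g e u <= 0.
  rewrite inflow_set_sum; apply: sumr_le0 => e _; rewrite !inE.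
  have := g14 e; case: ifP => hv; last by case: ifP; lra.
  have -> : connect (arrow o) (tl o e) v; last by lra.
  by apply: connect_trans hv; apply/connect1/existsP; exists e; rewrite !eqxx.
by rewrite leNgt U_pos.
Qed.

End Reversal.

Lemma lt_bounds (R : realType) (E : finType) (g : E -> R) : (forall e, 1 < g e < 4) ->
  exists2 d : R, 0 < d <= 1 & forall e, 1 + d <= g e <= 4 - d.
Proof.
move=> g14; pose h e := Num.min (g e - 1) (4 - g e).
exists (\big[Num.min/1]_e h e) => [|e].
  rewrite bigmin_le_id andbT; apply: lt_bigmin => // e _.
  by rewrite /h lt_min; have := g14 e; lra.
have : \big[Num.min/1]_e h e <= h e by apply: bigmin_le.
by rewrite /h le_min; lra.
Qed.

(** Strictness of the bounds is what makes room for scaling: finitely many values in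
    (1,4) lie in [1 + d, 4 - d] for some d > 0, and division by 1 + d brings them into
    [1, r - 1] with r < 5. *)
Lemma Phi_cP (R : realType) (G : mgraph) :
  (5%:E <= Phi_c R G)%E <-> ~ @modflow R G (fun=> iarc 1 4).
Proof.
have sym := @symmetric_iarc14 R; split.
  move=> Phi5 flow; have [o _] := orientation_exists G.
  have /(modflow_orient o)[//|f f_flow f14] := flow.
  have /boolp.choice[g gP] e : exists u : R, 1 < u < 4 /\ f e = pt u.
    by have := f14 e; rewrite iarcP // => -[u u1 ->]; exists u.
  have /boolp.choice[k kP] v : exists k : int, \sum_e inflow o g e v = 5 * k%:~R.
    apply: pt_int_eq0; rewrite inflow_sum ptB !pt_sum; apply/eqP; rewrite subr_eq0; apply/eqP.
    have := f_flow v; under eq_bigr do rewrite (proj2 (gP _)).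
    by under [X in _ = X -> _]eq_bigr do rewrite (proj2 (gP _)).
  have [|o' [g' [g'_flow g'14]]] := real_flow_of_mod5 _ kP; first by move=> e; have [] := gP e.
  have [d d01 dP] := lt_bounds g'14.
  have d0 : 0 < 1 + d by lra.
  suff : (Phi_c R G <= (1 + (4 - d) / (1 + d))%:E)%E.
    move=> /(le_trans Phi5); rewrite lee_fin -lerBlDl ler_pdivlMr //; lra.
  apply: ereal_inf_lbound; exists (1 + (4 - d) / (1 + d)) => //; split.
    by rewrite -lerBlDl ler_pdivlMr //; lra.
  exists o', (fun e => g' e / (1 + d)); split=> [v|e].
    by rewrite -!mulr_suml g'_flow.
  rewrite ler_pdivlMr // addrAC subrr add0r ler_pM2r ?invr_gt0 //.
  by have := dP e; lra.
move=> noflow; rewrite leNgt; apply/negP => /ereal_inf_lt[_ [r [r2 [o [f [f_flow f_r]]]] <-]].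
rewrite lte_fin => r5; apply: noflow; apply/(modflow_orient o) => //.
have [c [c1 cr]] : exists c : R, 1 < c /\ c * (r - 1) < 4.
  have r0 : 0 < r - 1 by lra.
  exists ((1 + 4 / (r - 1)) / 2); split.
    suff : 1 < 4 / (r - 1) by lra.
    by rewrite ltr_pdivlMr //; lra.
  have -> : (1 + 4 / (r - 1)) / 2 * (r - 1) = ((r - 1) + 4) / 2 by field; lra.
  by lra.
exists (fun e => pt (c * f e)) => [v|e].
  by rewrite -!pt_sum -!mulr_sumr f_flow.
apply: iarc_pt => //; have := f_r e => /andP[f1 f2].
have h : c * f e <= c * (r - 1) by rewrite ler_pM2l //; lra.
have h' : c * 1 <= c * f e by rewrite ler_pM2l //; lra.
lra.
Qed.

(** * Replacing edges by generalised edges *)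

Lemma sum_sigma (V : nmodType) (E : finType) (A : E -> finType) (F : {e : E & A e} -> V) :
  \sum_x F x = \sum_e \sum_(a : A e) F (Tagged A a).
Proof.
rewrite (sig_big_dep _ (fun _ => xpredT) (fun e a => F (Tagged A a))) /=.
by apply: eq_bigr => -[].
Qed.

Lemma sum_option (V : nmodType) (E : finType) (F : option E -> V) :
  \sum_x F x = F None + \sum_e F (Some e).
Proof.
rewrite (bigD1 None) //=; congr (_ + _).
rewrite (reindex_omap Some id) /=; last by case.
by apply: eq_bigl => e; rewrite eqxx.
Qed.

Lemma sum_two (V : nmodType) (A : finType) (x y : A) (P : pred A) (F : A -> V) :
  x != y -> (forall v, v != x -> v != y -> F v = 0) ->
  \sum_(v | P v) F v = (if P x then F x else 0) + (if P y then F y else 0).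
Proof.
move=> xy F0; rewrite big_mkcond (bigD1 x) //= (bigD1 y) 1?eq_sym //=.
by rewrite big1 ?addr0 // => v /andP[vx vy]; rewrite F0 // if_same.
Qed.

Lemma sum_injective (V : nmodType) (A B : finType) (h : A -> B) (F : B -> V) :
  injective h -> (forall b, b \notin codom h -> F b = 0) ->
  \sum_a F (h a) = \sum_b F b.
Proof.
move=> h_inj F0; rewrite [RHS](bigID (mem (codom h))) /= [X in _ + X]big1 // addr0.
have -> : \sum_a F (h a) = \sum_(a in A) F (h a) by apply: eq_bigl.
rewrite -big_imset //=; last by move=> ? ? _ _; apply: h_inj.
apply: eq_bigl => b; apply/imsetP/codomP => [[a _ ->]|[a ->]]; exists a => //.
Qed.

Lemma balancedN (V : zmodType) (G : mgraph) (phi : edge G -> vert G -> V) :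
  balanced phi -> balanced (fun e v => - phi e v).
Proof.
move=> [off sume sumv]; split=> [e v nv|e|v]; rewrite ?sumrN ?sume ?sumv ?oppr0 //.
by rewrite off ?oppr0.
Qed.

(** Orientations of the added edge give z or its opposite at the first terminal, and
    balanced functions are closed under negation. *)
Lemma CP5P (R : realType) (K : gedge) (z : circ5 R) :
  CP5 K R z <-> exists psi : edge (gplus K) -> vert K -> circ5 R,
    [/\ @balanced _ (gplus K) psi,
        forall e v, v \in ends e -> iarc 1 4 (psi (Some e) v) & z = psi None (term1 K)].
Proof.
have sym := @symmetric_iarc14 R.
have sym' (u : circ5 R) : iarc 1 4 u -> iarc 1 4 (- u) by move/sym.
split=> [[o [f [f_flow f_c ->]]]|[psi [psi_bal psi_c ->]]].
  have f_c' e v : v \in ends e -> iarc 1 4 (inflow o f (Some e) v).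
    have := @in_ends _ o (Some e) v => /= -> /orP[] /eqP->.
      by rewrite inflow_tl; apply: sym'.
    by rewrite inflow_hd.
  have := @in_ends _ o None (term1 K); rewrite /= !inE eqxx => /esym/orP[/eqP t1|/eqP t1].
    exists (fun e v => - inflow o f e v); split=> [|e v /f_c'/sym'//|].
      exact/balancedN/is_flow_balanced.
    by rewrite t1 inflow_tl opprK.
  exists (inflow o f); split=> [|//|]; first exact: is_flow_balanced.
  by rewrite t1 inflow_hd.
have [o _] := orientation_exists (gplus K).
have f_c e : iarc 1 4 (psi (Some e) (hd o (Some e))).
  by apply: psi_c; have := @in_ends _ o (Some e) (hd o (Some e)); rewrite eqxx orbT.
have := @in_ends _ o None (term1 K); rewrite /= !inE eqxx => /esym/orP[/eqP t1|/eqP t1].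
  exists o, (fun e => - psi e (hd o e)); split=> [|e|].
  - by apply: (balanced_is_flow o (phi := fun e v => - psi e v)); apply: balancedN.
  - exact: sym'.
  - by rewrite {1}t1 (balanced_tl o None psi_bal).
exists o, (fun e => psi e (hd o e)); split=> [|//|]; first exact: balanced_is_flow.
by rewrite {1}t1.
Qed.

Section ReplaceEdges.
Variables (R : realType) (H : mgraph) (o : orientation H) (K : edge H -> gedge).
Let G := replace_edges o K.

Definition inside e (a : edge (K e)) : edge G := Tagged (fun e => edge (K e)) a.

Lemma place_term1 e : place o (term1 (K e)) = inl (tl o e).
Proof. by rewrite /place; case: insubP => [w|_]; rewrite ?eqxx. Qed.

Lemma place_term2 e : place o (term2 (K e)) = inl (hd o e).
Proof.
rewrite /place; case: insubP => [w|_]; first by rewrite eqxx andbF.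
by rewrite eq_sym (negbTE (term_neq (K e))).
Qed.

Lemma place_inner e (w : inner K e) : place o (val w) = inr (Tagged (inner K) w).
Proof. by rewrite /place valK. Qed.

Lemma place_inr_tag e e' (u : vert (K e)) (w : inner K e') :
  place o u = inr (Tagged (inner K) w) -> e = e'.
Proof. by rewrite /place; case: insubP => // w' _ _ E; exact: (congr1 (@tag _ _) (@inr_inj _ _ _ _ E)). Qed.

(** From left to right, the edge e of H carries the total flow of the edges of
    K e into a terminal, and the added edge of K e returns the same amount.  From right
    to left, flows of the graphs K e that agree with the given flow on the added edges
    are put side by side: at each vertex of H the contributions of the added edges
    cancel. *)
Lemma replace_modflow (sigma : edge H -> set (circ5 R)) :
  (forall e, CP5 (K e) R = sigma e) -> @modflow R G (fun=> iarc 1 4) <-> modflow sigma.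
Proof.
move=> K_sigma; split=> [[phi [off sumv sume] phi_c]|[Phi Phi_bal Phi_c]].
  have rends_place (e : edge H) (a : edge (K e)) w :
      (@place H o K e w \in ends (inside a)) = (w \in ends a).
    by rewrite [LHS](mem_imset _ _ (@place_inj _ o K e)).
  pose psi (e : edge H) (a : option (edge (K e))) (w : vert (K e)) : circ5 R :=
    if a is Some a then phi (inside a) (place o w)
    else - \sum_(a : edge (K e)) phi (inside a) (place o w).
  have psi_bal e : @balanced _ (gplus (K e)) (psi e).
    split=> [[a|] w|[a|]|w] /=.
    - by move=> wa; rewrite off // rends_place.
    - rewrite !inE negb_or => w_inner; apply/eqP; rewrite oppr_eq0; apply/eqP.
      pose w' : inner K e := Sub w w_inner.
      rewrite -[w]/(val w') place_inner.
      rewrite -[RHS](sume (inr (Tagged (inner K) w') : vert G)) [RHS]sum_sigma (bigD1 e) //=.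
      rewrite [X in _ = _ + X]big1 ?addr0 // => e' ne; rewrite big1 // => a _.
      apply: off; apply/negP => /imsetP[u _ /esym/place_inr_tag /= E].
      by rewrite E eqxx in ne.
    - rewrite (sum_injective (F := phi _)) ?sumv //; first exact: place_inj.
      move=> x xK; apply: off; apply: contra xK => /imsetP[u _ ->]; exact: codom_f.
    - rewrite sumrN exchange_big /= big1 ?oppr0 // => a _.
      rewrite (sum_injective (F := phi _)) ?sumv //; first exact: place_inj.
      move=> x xK; apply: off; apply: contra xK => /imsetP[u _ ->]; exact: codom_f.
    - by rewrite sum_option /= addrC subrr.
  have psi_terms e : psi e None (term2 (K e)) = - psi e None (term1 (K e)).
    have [off' sumv' _] := psi_bal e.
    apply/eqP; rewrite -addr_eq0 addrC; apply/eqP; rewrite -[RHS](sumv' None).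
    rewrite (sum_two (x := term1 (K e)) (y := term2 (K e))) ?term_neq // => v v1 v2.
    by apply: off'; rewrite /= !inE negb_or v1.
  pose Phi e v : circ5 R := \sum_(a : edge (K e)) phi (inside a) (inl v : vert G).
  have Phi_tl e : Phi e (tl o e) = - psi e None (term1 (K e)).
    by rewrite /psi place_term1 opprK.
  have Phi_hd e : Phi e (hd o e) = psi e None (term1 (K e)).
    by rewrite -[RHS]opprK -psi_terms /psi place_term2 opprK.
  have Phi_off e v : v \notin ends e -> Phi e v = 0.
    rewrite (in_ends o) => /norP[vt vh]; rewrite /Phi big1 // => a _; apply: off.
    apply/negP => /imsetP[u _]; rewrite /place; case: insubP => [? _ _ //|_ [E]].
    by move: E vt vh => /= ->; case: ifP => _; rewrite eqxx.
  exists Phi.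
    split=> // [e|v].
      rewrite (sum_two (x := tl o e) (y := hd o e)) ?tl_neq_hd //.
        by rewrite Phi_tl Phi_hd addNr.
      by move=> v vt vh; apply: Phi_off; rewrite (in_ends o) negb_or vt.
    by rewrite -[RHS](sume (inl v : vert G)) [RHS]sum_sigma.
  have cap e : sigma e (psi e None (term1 (K e))).
    rewrite -K_sigma; apply/CP5P; exists (psi e); split=> // a w wa.
    by apply: phi_c; rewrite rends_place.
  have cap' e : sigma e (- psi e None (term1 (K e))).
    rewrite -K_sigma; apply/CP5P; exists (fun a w => - psi e a w); split=> //.
      exact: (balancedN (psi_bal e)).
    by move=> a w wa; apply/symmetric_iarc14; rewrite opprK; apply: phi_c; rewrite rends_place.
  by move=> e v; rewrite (in_ends o) => /orP[] /eqP->; rewrite ?Phi_tl ?Phi_hd.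
have psi_ex e : {psi : edge (gplus (K e)) -> vert (K e) -> circ5 R |
   [/\ @balanced _ (gplus (K e)) psi,
        forall a v, v \in ends a -> iarc 1 4 (psi (Some a) v)
        & Phi e (hd o e) = psi None (term1 (K e))]}.
  apply: boolp.cid; apply/CP5P; rewrite K_sigma; apply: Phi_c.
  by rewrite (in_ends o) eqxx orbT.
pose psi e := sval (psi_ex e).
have psi_bal e : @balanced _ (gplus (K e)) (psi e) by case: (svalP (psi_ex e)).
have psi_c e a v : v \in ends a -> iarc 1 4 (psi e (Some a) v).
  by case: (svalP (psi_ex e)) => _ + _; apply.
have psi_t1 e : psi e None (term1 (K e)) = Phi e (hd o e).
  by case: (svalP (psi_ex e)) => _ _ ->.
have psi_t2 e : psi e None (term2 (K e)) = Phi e (tl o e).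
  have [off' sumv' _] := psi_bal e.
  rewrite (balanced_tl o e Phi_bal) -psi_t1.
  apply/eqP; rewrite -addr_eq0 addrC; apply/eqP; rewrite -[RHS](sumv' None).
  rewrite (sum_two (x := term1 (K e)) (y := term2 (K e))) ?term_neq // => v v1 v2.
  by apply: off'; rewrite /= !inE negb_or v1.
pose phi (x : edge G) (y : vert G) : circ5 R :=
  \sum_(w | place o w == y) psi (tag x) (Some (tagged x)) w.
exists phi; last first.
  move=> [e a] v /imsetP[w wa ->]; rewrite /phi /= (big_pred1 w); first exact: psi_c.
  by move=> u /=; rewrite (inj_eq (@place_inj _ o K e)).
split=> [[e a] y ya|[e a]|y].
- rewrite /phi /= big1 // => w /eqP Ew; have [off' _ _] := psi_bal e; apply: off'.
  by apply: contra ya => wa; rewrite -Ew; apply: imset_f.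
- have [_ sumv' _] := psi_bal e; rewrite -[RHS](sumv' (Some a)).
  by rewrite [RHS](partition_big (place o (K := K) (e := e)) xpredT).
rewrite [LHS]sum_sigma.
have [_ _ Phi_sum] := Phi_bal.
transitivity (\sum_e ((if inl (tl o e) == y then - Phi e (hd o e) else 0)
                     + (if inl (hd o e) == y then - Phi e (tl o e) else 0))).
  apply: eq_bigr => e _; rewrite /phi /= exchange_big /=.
  rewrite (eq_bigr (fun w => - psi e None w)) => [|w _].
    rewrite (sum_two (x := term1 (K e)) (y := term2 (K e))) ?term_neq //.
      by rewrite place_term1 place_term2 psi_t1 psi_t2.
    move=> w w1 w2; have [off' _ _] := psi_bal e.
    by rewrite off' ?oppr0 //= !inE negb_or w1.
  have [_ _ sume'] := psi_bal e; apply/eqP; rewrite -addr_eq0 addrC.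
  by rewrite -[X in _ == X](sume' w) sum_option.
case: y => [v|w]; last by rewrite big1 // => e _; rewrite addr0.
rewrite -[RHS](Phi_sum v); apply: eq_bigr => e _.
rewrite (balanced_inflow o e v Phi_bal) (balanced_tl o e Phi_bal) opprK /inflow addrC.
rewrite !(inj_eq (@inl_inj _ _)).
by congr (_ + _); case: ifP; rewrite ?oppr0.
Qed.

End ReplaceEdges.

(** * Cyclic sequences: constructions *)

Definition capacity (R : realType) (I : set (circ5 R)) (b : bool) : set (circ5 R) :=
  if b then I else iarc 1 4.

(** With s marking the external edges in J, the two conditions are the capacities of
    the external edge i and of the spoke between it and the edge i + 1. *)
Definition admissible (R : realType) (I : set (circ5 R)) (s : nat -> bool)
    (x : nat -> R) (i : nat) : Prop :=
  capacity I (s i) (pt (x i)) /\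
  capacity I (s i (+) s i.+1) (pt (x i.+1 - x i)).

Definition solvable (R : realType) (I : set (circ5 R)) (n : nat) (s : nat -> bool) :=
  exists2 x : nat -> R, (forall i, x (i + n)%N = x i)
                      & forall i, admissible I s x i.

Lemma periodicM (T : Type) (n : nat) (s : nat -> T) (sn : forall i, s (i + n)%N = s i)
  c i : s (i + c * n)%N = s i.
Proof. by elim: c => [|c IH]; rewrite ?addn0 // mulSn addnCA addnC sn. Qed.

Lemma solvable_shift (R : realType) (I : set (circ5 R)) (n : nat)
    (s : nat -> bool) (sn : forall i, s (i + n)%N = s i) (c : nat) : (0 < n)%N ->
  solvable I n (fun i => s (c + i)%N) -> solvable I n s.
Proof.
case: n sn => // n sn _ [x xn x_ok].
exists (fun i => x (c * n + i)%N) => i; first by rewrite addnA xn.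
have := x_ok (c * n + i)%N; rewrite /admissible -addnS !addnA -mulnS.
by rewrite ![(c * n.+1 + _)%N]addnC !(periodicM sn).
Qed.

Lemma solvable_fold (R : realType) (I : set (circ5 R)) (n : nat) (s : nat -> bool)
    (sn : forall i, s (i + n)%N = s i) (y : nat -> R) : (0 < n)%N ->
  (forall i, (i < n)%N -> capacity I (s i) (pt (y i))) ->
  (forall i, (i.+1 < n)%N -> capacity I (s i (+) s i.+1) (pt (y i.+1 - y i))) ->
  capacity I (s n.-1 (+) s 0%N) (pt (y 0%N - y n.-1)) -> solvable I n s.
Proof.
move=> n0 y_ok y_step y_wrap; exists (fun i => y (i %% n)%N) => i.
  by rewrite modnDr.
have sE j : s (j %% n)%N = s j.
  by rewrite [in RHS](divn_eq j n) addnC periodicM.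
have iS : (i.+1 %% n = (i %% n).+1 %% n)%N by rewrite -[i.+1]addn1 -[(i %% n).+1]addn1 modnDml.
rewrite /admissible -(sE i) -(sE i.+1) iS.
have ltin : (i %% n < n)%N by rewrite ltn_mod.
split; first exact: y_ok.
move: ltin; rewrite leq_eqVlt => /orP[/eqP E|lt].
  by rewrite E modnn; have -> : (i %% n = n.-1)%N by apply: (congr1 predn E).
by rewrite (modn_small lt); apply: y_step.
Qed.

Section Alternating.
Variables (R : realType) (I : set (circ5 R)) (hI : SI5 I).
Variables (n : nat) (s : nat -> bool).
Hypotheses (n0 : (0 < n)%N) (sn : forall i, s (i + n)%N = s i).

Lemma capacityN b (u : R) : capacity I b (pt u) -> capacity I b (pt (- u)).
Proof. by case: b; [apply: SI5N|rewrite ptN => /symmetric_iarc14]. Qed.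

Lemma capacity_sign b i (u : R) :
  capacity I b (pt u) -> capacity I b (pt ((-1) ^+ i * u)).
Proof.
by rewrite -signr_odd; case: odd; rewrite ?expr0 ?expr1 ?mul1r ?mulN1r //; apply: capacityN.
Qed.

Variables (a b : R).
Hypotheses (ha : I (pt a)) (hb : iarc 1 4 (pt b)) (haa : iarc 1 4 (pt (a + a)))
  (hab : I (pt (a + b))) (hbb : iarc 1 4 (pt (b + b))).

Definition level i : R := if s i then a else b.
Definition alternate i : R := (-1) ^+ i * level i.

Lemma level_cap i : capacity I (s i) (pt (level i)).
Proof. by rewrite /level; case: (s i). Qed.

Lemma alternate_cap i : capacity I (s i) (pt (alternate i)).
Proof. exact/capacity_sign/level_cap. Qed.

Lemma levelD_cap i j : capacity I (s i (+) s j) (pt (level j + level i)).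
Proof. by rewrite /level; case: (s i); case: (s j) => //=; rewrite addrC. Qed.

Lemma alternate_step i :
  capacity I (s i (+) s i.+1) (pt (alternate i.+1 - alternate i)).
Proof.
have -> : alternate i.+1 - alternate i = (-1) ^+ i.+1 * (level i.+1 + level i).
  by rewrite /alternate !exprS; ring.
exact/capacity_sign/levelD_cap.
Qed.

Lemma solvable_even : ~~ odd n -> solvable I n s.
Proof.
move=> en; apply: (solvable_fold sn (y := alternate)) => // [i _|i _|].
- exact: alternate_cap.
- exact: alternate_step.
have -> : alternate 0 - alternate n.-1 = level 0%N + level n.-1.
  rewrite /alternate -(signr_odd _ n.-1); have -> : odd n.-1 by case: n n0 en => //= m _; rewrite negbK.
  by rewrite expr0 expr1; ring.
exact: levelD_cap.
Qed.

(** For odd n the signs of [alternate] do not close up.  Here they are shifted by one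
    from index m on, so that the step from n - 1 back to 0 alternates again; what is
    left is to pass from the sign at 0 to the wrong sign at m. *)
Lemma solvable_patch (m : nat) (y : nat -> R) : odd n -> (m < n)%N ->
  y 0%N = level 0 ->
  (forall i, (i < m)%N -> admissible I s y i) ->
  (forall i, (m <= i)%N -> y i = - alternate i) -> solvable I n s.
Proof.
move=> on mn y0 y_lt y_ge; apply: (solvable_fold sn (y := y)) => // [i _|i _|].
- have [/y_lt[]//|/y_ge ->] := ltnP i m.
  exact/capacityN/alternate_cap.
- have [/y_lt[]//|mi] := ltnP i m.
  rewrite !y_ge ?leqW // -opprD; exact/capacityN/alternate_step.
have -> : y 0%N - y n.-1 = level 0 + level n.-1.
  rewrite y0 y_ge ?opprK; last by case: n mn n0.
  rewrite /alternate -(signr_odd _ n.-1).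
  have -> : odd n.-1 = false by case: n n0 on => //= k _ /negbTE.
  by rewrite expr0 mul1r.
exact: levelD_cap.
Qed.

(** The value d accepts both signs at its neighbours, so it can sit where the
    alternation closes up, whatever the parity of n. *)
Lemma solvable_defect (d : R) : I (pt d) ->
  (forall e : R, e = a \/ e = - a -> iarc 1 4 (pt (d - e))) ->
  (forall e : R, e = b \/ e = - b -> I (pt (d - e))) ->
  s 0%N -> (1 < n)%N -> solvable I n s.
Proof.
move=> hd hda hdb s0 n1.
pose y i := if i == 0%N then d else alternate i.
have d_step i : capacity I (~~ s i) (pt (d - alternate i)).
  have [] : alternate i = level i \/ alternate i = - level i.
    by rewrite /alternate -signr_odd; case: odd; rewrite ?expr1 ?expr0 ?mul1r ?mulN1r; [right|left].
  - by move=> ->; rewrite /level; case: (s i) => /=; [apply: hda; left|apply: hdb; left].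
  - by move=> ->; rewrite /level; case: (s i) => /=; [apply: hda; right|apply: hdb; right].
apply: (solvable_fold sn (y := y)) => // [i _|i _|].
- rewrite /y; case: eqP => [->|_]; first by rewrite s0.
  exact: alternate_cap.
- rewrite /y /=; case: eqP => [->|_]; last exact: alternate_step.
  by rewrite s0 -opprB; apply/capacityN/d_step.
rewrite {1}/y /= s0 addbT /y; case: eqP => [E|_]; last exact: d_step.
by case: n n1 E => [|[]].
Qed.

End Alternating.

Section Solvable.
Variables (R : realType) (I : set (circ5 R)) (hI : SI5 I).
Variables (n : nat) (s : nat -> bool).
Hypotheses (n3 : (3 <= n)%N) (sn : forall i, s (i + n)%N = s i).

Let n0 : (0 < n)%N. Proof. exact: leq_trans n3. Qed.

Let shift_periodic c i : s (c + (i + n))%N = s (c + i)%N.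
Proof. by rewrite addnA sn. Qed.

(** The constants in the three cases satisfy the same requirements: a, d, a + b, d - b
    and d + b belong to I, while b, 2a, 2b, d - a and d + a belong to (1,4). *)
Lemma solvable_two (j : nat) : s j ->
  [\/ I (pt (1 / 2)) /\ I (pt (3 / 2)), I (pt (1 / 2)) /\ I (pt (5 / 2))
    | I (pt (3 / 2)) /\ I (pt (5 / 2))] -> solvable I n s.
Proof.
move=> sj atoms; apply: (solvable_shift sn (c := j)) => //.
have s0 : s (j + 0)%N by rewrite addn0.
have n1 : (1 < n)%N by apply: leq_trans n3.
case: atoms => -[A B].
- by apply: (solvable_defect hI n0 (shift_periodic j) (a := 9/5) (b := 3/2)
    _ _ _ _ _ (d := 1/10)) => // [||||||e [] ->|e [] ->];
    [apply: (SI5_12 hI B)|apply/iarc14_real|apply/iarc14_real|apply: (SI5_12 hI B)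
    |apply/iarc14_real|apply: (SI5_01 hI A)|apply/iarc14_real|apply/iarc14_real
    |apply: (SI5_12 hI B)|apply: (SI5_12 hI B)]; lra.
- by apply: (solvable_defect hI n0 (shift_periodic j) (a := 9/10) (b := - (8/5))
    _ _ _ _ _ (d := 5/2)) => // [|||||e [] ->|e [] ->];
    [apply: (SI5_01 hI A)|apply/iarc14_real|apply/iarc14_real|apply: (SI5_01 hI A)
    |apply/iarc14_real|apply/iarc14_real|apply/iarc14_real
    |rewrite -(pt_shift _ (-1)) intrN; apply: (SI5_01 hI A)|apply: (SI5_01 hI A)]; lra.
- by apply: (solvable_defect hI n0 (shift_periodic j) (a := 6/5) (b := 7/5)
    _ _ _ _ _ (d := 5/2)) => // [|||||e [] ->|e [] ->];
    [apply: (SI5_12 hI A)|apply/iarc14_real|apply/iarc14_real|apply: (SI5_23 hI B)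
    |apply/iarc14_real|apply/iarc14_real|apply/iarc14_real
    |apply: (SI5_12 hI A)|apply: (SI5_12 hI A)]; lra.
Qed.

Lemma solvable_01_even : I (pt (1 / 2)) -> ~~ odd n -> solvable I n s.
Proof.
move=> A; apply: (solvable_even hI n0 sn (a := 9/10) (b := - (13/10)));
  [apply: (SI5_01 hI A)|apply/iarc14_real|apply/iarc14_real|apply: (SI5_01 hI A)
    |apply/iarc14_real]; lra.
Qed.

(** The middle one of three consecutive edges outside J gets 5/2, the point opposite
    to 0, which is more than 1 away from both 13/10 and -13/10.  So its neighbours can
    take these two values, where an alternating sequence would have equal ones. *)
Lemma solvable_01_odd (j : nat) : I (pt (1 / 2)) -> odd n ->
  ~~ [|| s j, s j.+1 | s j.+2] -> solvable I n s.
Proof.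
move=> A on /norP[/negbTE s0 /norP[/negbTE s1 /negbTE s2]].
apply: (solvable_shift sn (c := j)) => //.
have {}s0 : s (j + 0)%N = false by rewrite addn0.
have {}s1 : s (j + 1)%N = false by rewrite addn1.
have {}s2 : s (j + 2)%N = false by rewrite addn2.
pose a : R := 9/10; pose b : R := - (13/10); pose s' i := s (j + i)%N.
pose y i := if i == 0%N then level s' a b 0 else if i == 1%N then 5/2 else - alternate s' a b i.
apply: (solvable_patch hI n0 (shift_periodic j) (a := a) (b := b) _ _ _ _ _ (m := 2) (y := y)) => //;
  try by [apply: (SI5_01 hI A); rewrite /a /b; lra|apply/iarc14_real; rewrite /a /b; lra|case=> [|[|]]].
move=> [|[|//]] _; rewrite /admissible /y /= /alternate /level /s' ?s0 ?s1 ?s2 /=.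
  by split; apply/iarc14_real; rewrite /b; lra.
by rewrite expr2 mulN1r opprK mul1r; split; apply/iarc14_real; rewrite /b; lra.
Qed.

Lemma solvable_12_even : I (pt (3 / 2)) -> ~~ odd n -> solvable I n s.
Proof.
move=> B; apply: (solvable_even hI n0 sn (a := 6/5) (b := 19/10));
  [apply: (SI5_12 hI B)|apply/iarc14_real|apply/iarc14_real|apply: (SI5_12 hI B)
    |apply/iarc14_real]; lra.
Qed.

(** If the edge after j + 1 is in J, the value 5/2 at j + 1 is at distance 13/10 from
    both 6/5 and -6/5.  Otherwise the values 12/5 and 7/2 at j + 1 and j + 2 lead from
    6/5 to a positive value at j + 3; if j + 3 is in J this value must be larger than
    6/5 (here 8/5), which is impossible for n = 3, when j + 3 is j itself. *)
Lemma solvable_12_odd (j : nat) : I (pt (3 / 2)) -> odd n ->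
  s j -> ~~ s j.+1 -> (3 < n)%N || s j.+2 -> solvable I n s.
Proof.
move=> B on s0 /negbTE s1 s2.
apply: (solvable_shift sn (c := j)) => //.
have {}s0 : s (j + 0)%N = true by rewrite addn0.
have {}s1 : s (j + 1)%N = false by rewrite addn1.
have {}s2 : (3 < n)%N || s (j + 2)%N by rewrite addn2.
pose a : R := 6/5; pose b : R := 19/10; pose s' i := s (j + i)%N.
have [s2'|/negbTE s2'] := boolP (s (j + 2)%N).
  pose y i := if i == 0%N then level s' a b 0 else if i == 1%N then 5/2 else - alternate s' a b i.
  apply: (solvable_patch hI n0 (shift_periodic j) (a := a) (b := b) _ _ _ _ _ (m := 2) (y := y)) => //;
    try by [apply: (SI5_12 hI B); rewrite /a /b; lra|apply/iarc14_real; rewrite /a /b; lra|case=> [|[|]]].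
  move=> [|[|//]] _; rewrite /admissible /y /= /alternate /level /s' ?s0 ?s1 ?s2' /=.
    by split; apply: (SI5_12 hI B); rewrite /a; lra.
  rewrite expr2 mulN1r opprK mul1r; split; first by apply/iarc14_real; lra.
  by apply: (SI5_12 hI B); rewrite /a; lra.
have n5 : (4 < n)%N.
  by move: s2 on; rewrite s2' orbF leq_eqVlt => /orP[/eqP <-|].
pose y i := if i is 0%N then a else if i is 1%N then 12/5 else if i is 2%N then 7/2
            else if i is 3%N then (if s (j + 3)%N then 8/5 else b) else - alternate s' a b i.
apply: (solvable_patch hI n0 (shift_periodic j) (a := a) (b := b) _ _ _ _ _ (m := 4) (y := y)) => //;
  try by [apply: (SI5_12 hI B); rewrite /a /b; lra|apply/iarc14_real; rewrite /a /b; lra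
         |rewrite /level s0|case=> [|[|[|[|]]]]].
move=> [|[|[|[|//]]]] _; rewrite /admissible /y /= /alternate /level /s' ?s0 ?s1 ?s2' /=.
- by split; [apply: (SI5_12 hI B)|apply: (SI5_12 hI B)]; rewrite /a; lra.
- by split; apply/iarc14_real; lra.
- split; first by apply/iarc14_real; lra.
  by case: (s (j + 3)%N) => /=; [apply: (SI5_12 hI B)|apply/iarc14_real]; rewrite /b; lra.
- have -> : (-1) ^+ 4 = 1 :> R by rewrite -signr_odd.
  by case: (s (j + 3)%N) => /=; case: (s (j + 4)%N) => /=; split;
    rewrite /a /b; first [apply: (SI5_12 hI B); lra | apply/iarc14_real; lra].
Qed.

End Solvable.

(** * Cyclic sequences: obstructions *)

Lemma solvable_repr (R : realType) (I : set (circ5 R)) (n : nat) (s : nat -> bool) :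
  solvable I n s -> exists x : nat -> R,
    [/\ forall i, x (i + n)%N = x i, forall i, -1 <= x i < 4,
        forall i, s i -> I (pt (x i)), forall i, ~~ s i -> 1 < x i < 4
      & forall i, capacity I (s i (+) s i.+1) (pt (x i.+1 - x i))].
Proof.
move=> [x xn x_ok].
have /(boolp.choice (X := circ5 R) (Y := R))[rho rhoP] : forall z : circ5 R, exists u, -1 <= u < 4 /\ z = pt u.
  by move=> z; have [u u1 Eu] := pt_repr z; exists u.
have rhoE i : pt (rho (pt (x i))) = pt (x i) by rewrite -(proj2 (rhoP _)).
exists (fun i => rho (pt (x i))); split=> [i|i|i si|i /negbTE si|i].
- by rewrite xn.
- by have [] := rhoP (pt (x i)).
- by have [+ _] := x_ok i; rewrite si rhoE.
- have [+ _] := x_ok i; rewrite si /= -{1}rhoE.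
  have [u1 _] := rhoP (pt (x i)); rewrite iarc14_real; last by lra.
  by lra.
- by have [_] := x_ok i; rewrite !ptB !rhoE.
Qed.

Lemma alternating_even (n : nat) (t : nat -> bool) :
  (forall i, t (i + n)%N = t i) -> (forall i, t i.+2 = ~~ t i.+1) -> ~~ odd n.
Proof.
move=> tn tS; have tE i : t i.+1 = t 1%N (+) odd i.
  by elim: i => [|i IH]; rewrite ?addbF // tS IH /= addbN.
by have := tn 1%N; rewrite add1n tE; case: odd; case: (t 1%N).
Qed.

(** At an end of an external edge in J, two edges in J meet a third one outside J, and
    sums and differences of elements of (2,3) lie in (-1,1). *)
Lemma unsolvable_iarc23 (R : realType) (n : nat) (s : nat -> bool) (j : nat) :
  s j -> ~ solvable (iarc 2 3 : set (circ5 R)) n s.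
Proof.
move=> sj /solvable_repr[x [_ xb xS xN xD]].
have {}xS i : s i -> 2 < x i < 3.
  have := xb i => xi /xS; rewrite iarc_real //; first by case; lra.
  by lra.
have h0 := xS _ sj; have h1 := xb j; have h2 := xb j.+1.
have := xD j; rewrite sj; case: (boolP (s j.+1)) => [/xS|/xN] h3 /=.
  by rewrite iarc14_real; lra.
by rewrite iarc_real //; [case; lra|lra].
Qed.

(** The truth value t i, namely x i > 0 inside J and x i > 5/2 outside J, changes at
    each step.  Inside J consecutive values are more than 1 apart in (-1,1), hence of
    opposite signs.  Between
    an edge of J and one outside J they are less than 1 apart, hence on the same side
    of 0, where t takes opposite values.  Outside J, each of at most two consecutive edges has a neighbour in J, so
    its value is in (1,2) or in (3,4), and the two cannot be in the same one. *)
Lemma unsolvable_iarc41 (R : realType) (I : set (circ5 R)) (n : nat) (s : nat -> bool) :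
  (I `<=` iarc 4 1)%classic -> odd n -> (forall i, s (i + n)%N = s i) ->
  (forall i, [|| s i, s i.+1 | s i.+2]) -> ~ solvable I n s.
Proof.
move=> I41 on sn run /solvable_repr[x [xn xb xS xN xD]].
have {}xS i : s i -> -1 < x i < 1.
  by move=> /xS /I41; rewrite iarc41_real; have := xb i; lra.
have xC i : s i (+) s i.+1 -> [|| -1 < x i.+1 - x i < 1, x i.+1 - x i < -4 | 4 < x i.+1 - x i].
  have := xD i; case: (s i (+) s i.+1) => //= /I41 + _.
  by rewrite iarc41_real; have := xb i; have := xb i.+1; lra.
have {}xD i : ~~ (s i (+) s i.+1) -> (1 < x i.+1 - x i < 4) || (-4 < x i.+1 - x i < -1).
  have := xD i; case: (s i (+) s i.+1) => //= + _.
  by rewrite iarc14_real; have := xb i; have := xb i.+1; lra.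
pose t i := if s i then 0 < x i else 5 / 2 < x i.
suff : ~~ odd n by rewrite on.
apply: (alternating_even (t := t)) => i; first by rewrite /t sn xn.
have low k : ~~ s k.+1 -> s k || s k.+2 -> x k.+1 < 2 \/ 3 < x k.+1.
  move=> sk' /orP[] sk; have := xN _ sk'; have := xS _ sk.
    by have := xC k; rewrite sk (negbTE sk') => /(_ isT); lra.
  by have := xC k.+1; rewrite sk (negbTE sk') => /(_ isT); lra.
have := (run i, run i.+1); rewrite /t.
have := (xC i.+1, xD i.+1).
have [s1|s1] := boolP (s i.+1); have [s2|s2] := boolP (s i.+2) => /= -[c d] [r1 r2].
- have := d isT; have := xS _ s1; have := xS _ s2.
  by case: ltP; case: ltP; lra.
- have := c isT; have := xS _ s1; have := xN _ s2.
  by case: ltP; case: ltP; lra.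
- have := c isT; have := xN _ s1; have := xS _ s2.
  by case: ltP; case: ltP; lra.
- move: r1 r2; rewrite !orbF => si s3.
  have := d isT; have := xN _ s1; have := xN _ s2.
  have := low i s1; have := low i.+1 s2; rewrite si s3 orbT => /(_ isT) + /(_ isT).
  by case: ltP; case: ltP; lra.
Qed.

Lemma iarc12_34_repr (R : realType) (I : set (circ5 R)) (u : R) :
  (I `<=` iarc 1 2 `|` iarc 3 4)%classic -> -6 < u < 6 -> I (pt u) ->
  [|| 1 < u < 2, 3 < u < 4, -4 < u < -3 | -2 < u < -1].
Proof.
move=> IB u6 /IB[]; rewrite iarc_real // => -[]; lra.
Qed.

Lemma unsolvable_full (R : realType) (I : set (circ5 R)) (n : nat) (s : nat -> bool) :
  (I `<=` iarc 1 2 `|` iarc 3 4)%classic -> odd n -> (forall i, s i) ->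
  ~ solvable I n s.
Proof.
move=> IB on sT /solvable_repr[x [xn xb xS _ xD]].
have {}xS i : (1 < x i < 2) || (3 < x i < 4).
  have h := xb i; have /(iarc12_34_repr IB) := xS _ (sT i); lra.
suff : ~~ odd n by rewrite on.
apply: (alternating_even (t := fun i => 5 / 2 < x i)) => i; first by rewrite xn.
have := xD i.+1; rewrite !sT /= iarc14_real; last by have := xb i.+1; have := xb i.+2; lra.
by have := xS i.+1; have := xS i.+2; case: ltP; case: ltP; lra.
Qed.

(** By the symmetry of K4 this is the external cycle again: of the three values that
    the flow has on the triangle, two lie in the same interval (1,2) or (3,4), and
    the edge at their common vertex gets a value at distance less than 1 from 0. *)
Lemma unsolvable_triangle (R : realType) (I : set (circ5 R)) (s : nat -> bool) (j : nat) :
    (I `<=` iarc 1 2 `|` iarc 3 4)%classic -> (forall i, s (i + 3)%N = s i) ->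
  s j -> ~~ s j.+1 -> ~~ s j.+2 -> ~ solvable I 3 s.
Proof.
move=> IB s_per s0 s1 s2 /solvable_repr[x [x_per xb xS xN xD]].
have s3 : s j.+3 by rewrite -addn3 s_per.
have x3 : x j.+3 = x j by rewrite -addn3 x_per.
have h1 := xN _ s1; have h2 := xN _ s2; have h0 := xb j.
have := xD j; have := xD j.+1; have := xD j.+2; have := xS _ s0.
rewrite s0 s3 (negbTE s1) (negbTE s2) x3 /=.
move=> /(iarc12_34_repr IB) + /(iarc12_34_repr IB) + + /(iarc12_34_repr IB).
by rewrite iarc14_real; lra.
Qed.

(** For n = 3 the absence of S N S leaves the full cycle and a single S, the two kinds
    of triangles. *)
Lemma not_solvableP (R : realType) (I : set (circ5 R)) (hI : SI5 I) (n : nat)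
    (n3 : (3 <= n)%N) (s : nat -> bool) (sn : forall i, s (i + n)%N = s i)
    (j : nat) (sj : s j) :
  ~ solvable I n s <->
  [\/ I = set0, I = iarc 2 3,
      [/\ (I `<=` iarc 4 1)%classic, odd n & forall i, [|| s i, s i.+1 | s i.+2]]
    | (I `<=` iarc 1 2 `|` iarc 3 4)%classic /\
      ([/\ (3 < n)%N, odd n & forall i, s i] \/
       n = 3%N /\ forall i, ~~ [&& s i, ~~ s i.+1 & s i.+2])].
Proof.
split=> [unsol|[->|->|[IA on run]|[IB [[_ on sT]|[En no101]]]]].
- have [[->|->]|[IA A]|[IB B]|/(solvable_two hI n3 sn sj)//] := SI5_cases hI.
  + by apply: Or41.
  + by apply: Or42.
  + have on : odd n by apply/negPn/negP => /(solvable_01_even hI n3 sn A).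
    apply: Or43; split=> // i; apply/negPn/negP.
    by move=> /(solvable_01_odd hI n3 sn A on).
  have on : odd n by apply/negPn/negP => /(solvable_12_even hI n3 sn B).
  apply: Or44; split=> //.
  have := n3; rewrite leq_eqVlt => /orP[/eqP En|n4]; [right|left].
    split=> // i; apply/negP => /and3P[s0 s1 s2].
    by apply: unsol; apply: (solvable_12_odd hI n3 sn B on s0 s1); rewrite s2 orbT.
  split=> // i; have -> : s i = s (j + (i + j * n - j))%N.
    rewrite subnKC; last by rewrite (leq_trans (leq_pmulr j (ltnW (ltnW n3)))) // leq_addl.
    by rewrite (periodicM sn).
  elim: (i + _ - j)%N => [|k IH]; first by rewrite addn0.
  rewrite addnS; apply/negPn/negP => sk.
  by apply: unsol; apply: (solvable_12_odd hI n3 sn B on IH sk); rewrite n4.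
- by move=> [x _ /(_ j)[]]; rewrite sj.
- exact: unsolvable_iarc23 sj.
- exact: unsolvable_iarc41.
- exact: unsolvable_full.
subst n; have := no101 j; have := no101 j.+1.
have s3 : s j.+3 = s j by rewrite -addn3 sn.
rewrite s3 sj /= andbT.
have [s1|s1] /= := boolP (s j.+1); have [s2|s2] //= := boolP (s j.+2).
  move=> _ _; apply: unsolvable_full => // i.
  have -> : s i = s (j + (i + j * 3 - j))%N.
    by rewrite subnKC; [rewrite (periodicM sn)|lia].
  elim/ltn_ind: (i + _ - j)%N => -[|[|[|k]]] IH; rewrite ?addn0 ?addn1 ?addn2 //.
  by rewrite !addnS -addn3 sn; apply: IH; lia.
move=> _ _; exact: unsolvable_triangle sj s1 s2.
Qed.

(** * Flows in wheels *)

Section WheelFlows.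
Variables (n : nat) (hn : (3 <= n)%N).

Fact wheel_gt0 : (0 < n)%N. Proof. exact: leq_trans hn. Qed.

(** Natural numbers read modulo n, so that the edge after k is k.+1 even at the last
    index. *)
Definition rim (k : nat) : 'I_n := Ordinal (ltn_pmod k wheel_gt0).

Lemma rim_val (i : 'I_n) : rim i = i.
Proof. by apply: val_inj; rewrite /= modn_small. Qed.

Lemma rim_addn k : rim (k + n) = rim k.
Proof. by apply: val_inj; rewrite /= modnDr. Qed.

Lemma rimS k : rim k.+1 = ordS (rim k).
Proof. by apply: val_inj; rewrite /= -[k.+1]addn1 -[(k %% n).+1]addn1 modnDml. Qed.

Lemma ord_pred_rimS k : ord_pred (rim k.+1) = rim k.
Proof. by rewrite rimS ordSK. Qed.

Lemma rim_ord_pred (i : 'I_n) : rim (ord_pred i).+1 = i.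
Proof. by rewrite rimS rim_val ord_predK. Qed.

Lemma rim_eq a b : (rim a == rim b) = (a == b %[mod n])%N.
Proof. by []. Qed.

Lemma ordS_neq (i : 'I_n) : ordS i != i.
Proof.
rewrite -[i]rim_val -rimS rim_eq -addn1 -[X in (_ == X %[mod _])%N]addn0.
by rewrite eqn_modDl mod0n modn_small // ltnW.
Qed.

Definition wheel_tl (e : edge (wheel hn)) : vert (wheel hn) :=
  match e with inl i => Some i | inr i => None end.

Definition wheel_hd (e : edge (wheel hn)) : vert (wheel hn) :=
  match e with inl i => Some (ordS i) | inr i => Some i end.

Fact wheel_endsE e : ends e = [set wheel_tl e; wheel_hd e]%SET.
Proof. by case: e => i //=; rewrite finset.setUC. Qed.

Definition wheel_orientation : orientation (wheel hn) := Orientation wheel_endsE.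

(** Conservation at the centre follows from the rest: the differences on the spokes
    sum to 0 around the cycle. *)
Lemma wheel_flowP (V : zmodType) (f : edge (wheel hn) -> V) :
  is_flow wheel_orientation f <->
  forall k, f (inr (rim k.+1)) = f (inl (rim k.+1)) - f (inl (rim k)).
Proof.
have hd_sum (j : 'I_n) : \sum_(e | wheel_hd e == Some j) f e = f (inl (ord_pred j)) + f (inr j).
  rewrite big_sumType /=; congr (_ + _); apply: big_pred1 => i /=; rewrite (inj_eq Some_inj) //.
  by rewrite -{1}[j](ord_predK j) (inj_eq (can_inj (@ordSK n))).
have tl_sum (j : 'I_n) : \sum_(e | wheel_tl e == Some j) f e = f (inl j).
  rewrite big_sumType /= [X in _ + X]big_pred0 // addr0.
  by apply: big_pred1 => i /=; rewrite (inj_eq Some_inj).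
split=> [flow k|f_inr [j|] /=].
- have := flow (Some (rim k.+1)); rewrite /= hd_sum tl_sum ord_pred_rimS => <-.
  by rewrite addrAC subrr add0r.
- by rewrite hd_sum tl_sum -[j]rim_ord_pred f_inr ord_pred_rimS addrC subrK.
rewrite !big_sumType /= !big_pred0_eq addr0 add0r.
have -> : \sum_i f (inr i) = \sum_i (f (inl i) - f (inl (ord_pred i))).
  by apply: eq_bigr => i _; rewrite -{1}[i]rim_ord_pred f_inr rim_ord_pred rim_val.
rewrite sumrB [X in _ - X](reindex_inj (can_inj (@ordSK n))).
by rewrite [X in _ - X](eq_bigr (fun i => f (inl i))) ?subrr // => i _; rewrite ordSK.
Qed.

Variable J : {set edge (wheel hn)}.
Hypothesis J_even : even_subgraph J.

Definition in_rim (k : nat) : bool := inl (rim k) \in J.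

Lemma in_rim_addn k : in_rim (k + n) = in_rim k.
Proof. by rewrite /in_rim rim_addn. Qed.

Lemma deg_rim (F : {set edge (wheel hn)}) k : deg F (Some (rim k.+1) : vert (wheel hn)) =
  ((inl (rim k) \in F) + (inl (rim k.+1) \in F) + (inr (rim k.+1) \in F))%N.
Proof.
rewrite /deg -sum1_card big_mkcond big_sumType /=; congr (_ + _)%N.
  transitivity (\sum_(i : 'I_n) (if (i == rim k) || (i == rim k.+1) then inl i \in F : nat else 0%N))%N.
    apply: eq_bigr => i _; rewrite !inE !(inj_eq Some_inj).
    have -> : (rim k.+1 == ordS i) = (i == rim k).
      by rewrite rimS (inj_eq (can_inj (@ordSK n))) eq_sym.
    by rewrite [rim k.+1 == i]eq_sym orbC; case: (_ || _); case: (inl i \in F).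
  rewrite (bigD1 (rim k)) //= eqxx /= (bigD1 (rim k.+1)) /=; last by rewrite rimS ordS_neq.
  rewrite eqxx orbT big1 ?addn0 // => i /andP[/negbTE-> /negbTE->] //.
rewrite (bigD1 (rim k.+1)) //= !inE eqxx big1 ?addn0 ?andbT; first by case: (inr _ \in F).
by move=> i ne; rewrite !inE !(inj_eq Some_inj) eq_sym (negbTE ne) andbF.
Qed.

(** The external vertex between the edges k and k + 1 has even degree in J. *)
Lemma spoke_in_J k : (inr (rim k.+1) \in J) = in_rim k (+) in_rim k.+1.
Proof.
have := J_even (Some (rim k.+1)); rewrite deg_rim !oddD !oddb -/(in_rim k) -/(in_rim k.+1).
by case: (in_rim k); case: (in_rim k.+1); case: (inr _ \in J).
Qed.

Lemma wheel_modflow (R : realType) (I : set (circ5 R)) (hI : SI5 I) :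
  @modflow R (wheel hn) (fun e => if e \in J then I else iarc 1 4) <->
  solvable I n in_rim.
Proof.
rewrite (modflow_orient wheel_orientation); last first.
  by move=> e; case: ifP => _; [have [] := hI | exact: symmetric_iarc14].
split=> [[f /wheel_flowP f_inr f_c]|[x xn x_c]].
  have /(boolp.choice (X := circ5 R) (Y := R))[rho rhoP] := @pt_surj R.
  exists (fun k => rho (f (inl (rim k)))) => k; first by rewrite rim_addn.
  rewrite /admissible ptB -!rhoP -f_inr /capacity -spoke_in_J; split; exact: f_c.
have xE k : x (k %% n)%N = x k.
  by rewrite [in RHS](divn_eq k n) addnC (periodicM xn).
exists (fun e : 'I_n + 'I_n => match e with inl i => pt (x i) | inr i => pt (x i) - pt (x (ord_pred i)) end).
  apply/wheel_flowP => k; congr (pt (x _) - pt (x _)).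
  exact: (congr1 val (ord_pred_rimS k)).
case=> i.
  have [+ _] := x_c i; rewrite /capacity /in_rim rim_val.
  exact.
have [_ ] := x_c (ord_pred i); rewrite /capacity -spoke_in_J rim_ord_pred ptB -(xE (ord_pred i).+1).
by have -> : ((ord_pred i).+1 %% n)%N = i by exact: (congr1 val (rim_ord_pred i)).
Qed.

End WheelFlows.

(** * Connectors and triangles in wheels *)

Lemma card_is_path (G : mgraph) (k : nat) (P : {set edge G}) : is_path k P -> (#|P| <= k)%N.
Proof.
move=> [v [p [_ _ <- ->]]]; rewrite cardsE -(size_map fst p).
exact: card_size.
Qed.

Lemma maximal_path_exists (G : mgraph) (F P : {set edge G}) (k : nat) :
  is_path k P -> P \subset F ->
  exists k' (P' : {set edge G}), P \subset P' /\ maximal_path F k' P'.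
Proof.
have [N] := ubnP #|~: P|%SET; elim: N P k => // N IH P k; rewrite ltnS => PN Pk PF.
have [[l [Q [Ql QF PQ QP]]]|P_max] :=
    pselect (exists l (Q : {set edge G}), [/\ is_path l Q, Q \subset F, P \subset Q & Q <> P]).
  have [|k' [P' [QP' P'_max]]] := IH Q l _ Ql QF.
    apply: leq_trans PN; apply: proper_card; rewrite finset.properEneq finset.setCS PQ andbT.
    by apply/eqP => /(can_inj (@finset.setCK _)).
  by exists k', P'; split=> //; apply: fintype.subset_trans QP'.
exists k, P; split=> //; split=> // l Q Ql QF PQ.
by apply: boolp.contrapT => QP; apply: P_max; exists l, Q.
Qed.

Section Connectors.
Variables (n : nat) (hn : (3 <= n)%N) (J : {set edge (wheel hn)}).
Hypothesis J_even : even_subgraph J.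
Local Notation s := (in_rim J).
Local Notation rim := (rim hn).

(** A path cannot turn back, so along the external cycle it keeps its direction. *)
Lemma rim_step (i j : 'I_n) (v w u : vert (wheel hn)) :
  @ends (wheel hn) (inl i) = [set v; w]%SET ->
  @ends (wheel hn) (inl j) = [set w; u]%SET -> v != u ->
  (w = Some (ordS i) /\ j = ordS i) \/ (w = Some i /\ i = ordS j).
Proof.
move=> /= Ei Ej vu.
have ne (k : 'I_n) : (Some (ordS k) == Some k) = false by apply/negbTE; apply: ordS_neq hn k.
have ne' (k : 'I_n) : (Some k == Some (ordS k)) = false by rewrite eq_sym ne.
have : w \in [set Some i; Some (ordS i)]%SET by rewrite Ei !inE eqxx orbT.
have : w \in [set Some j; Some (ordS j)]%SET by rewrite Ej !inE eqxx.
rewrite !inE => /orP[]/eqP Ewj /orP[]/eqP Ewi.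
- have : Some (ordS i) \in [set v; w]%SET by rewrite -Ei !inE eqxx orbT.
  have : Some (ordS j) \in [set w; u]%SET by rewrite -Ej !inE eqxx orbT.
  rewrite !inE {1}Ewj {1}Ewi !ne /= orbF => /eqP Eu /eqP Ev.
  by move: Ewj vu; rewrite Ewi -Eu -Ev => -[->]; rewrite eqxx.
- by left; split=> //; apply: Some_inj; rewrite -Ewi -Ewj.
- by right; split=> //; apply: Some_inj; rewrite -Ewi -Ewj.
- have : Some i \in [set v; w]%SET by rewrite -Ei !inE eqxx.
  have : Some j \in [set w; u]%SET by rewrite -Ej !inE eqxx.
  rewrite !inE {1}Ewj {1}Ewi !ne' /= orbF => /eqP Eu /eqP Ev.
  move: Ewj vu; rewrite Ewi -Eu -Ev => /Some_inj/(can_inj (@ordSK n)) ->; by rewrite eqxx.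
Qed.

Lemma in_rimP (e : edge (wheel hn)) : e \in (external_cycle hn :\: J)%SET ->
  exists2 i : 'I_n, e = inl i & ~~ s i.
Proof.
rewrite inE => /andP[eJ /imsetP[i _ E]]; exists i => //.
by rewrite /in_rim rim_val -E.
Qed.

Lemma in_rim_ordS (i : 'I_n) : s (ordS i) = s i.+1.
Proof. by rewrite /in_rim rimS !rim_val. Qed.

Lemma connector_run (k : nat) (C : {set edge (wheel hn)}) : (1 < k)%N ->
  connector J k C -> exists i, ~~ [|| s i, s i.+1 | s i.+2].
Proof.
move=> k1 [P [[[v [p [p_walk p_uniq p_size ->]]] PF _] _]].
have p3 : (2 < size p)%N by rewrite p_size.
case: p p3 p_walk p_uniq {p_size} PF => [|[e1 w1] [|[e2 w2] [|[e3 w3] p]]] //= _.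
move=> /and4P[/eqP E1 /eqP E2 /eqP E3 _] + /fintype.subsetP PF.
have /in_rimP[i1 Ei1 s1] : e1 \in (external_cycle hn :\: J)%SET by apply: PF; rewrite !inE eqxx.
have /in_rimP[i2 Ei2 s2] : e2 \in (external_cycle hn :\: J)%SET by apply: PF; rewrite !inE eqxx orbT.
have /in_rimP[i3 Ei3 s3] : e3 \in (external_cycle hn :\: J)%SET by apply: PF; rewrite !inE eqxx !orbT.
rewrite Ei1 Ei2 Ei3 in E1 E2 E3.
rewrite !inE !negb_or => /and5P[/and4P[_ vw2 _ _] /and3P[w12 w13 _] _ _ _].
have SS (i : 'I_n) : s (ordS (ordS i)) = s i.+2.
  by rewrite /in_rim -[i in LHS]rim_val -!rimS rim_val.
have [[Ew1 I1]|[Ew1 I1]] := rim_step E1 E2 vw2; have [[Ew2 I2]|[Ew2 I2]] := rim_step E2 E3 w13.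
- by exists i1; rewrite !negb_or s1 -in_rim_ordS -SS -I1 s2 -I2.
- by move: w12; rewrite Ew1 Ew2 I1 eqxx.
- by move: w12; rewrite Ew1 Ew2 I1 eqxx.
- by exists i3; rewrite !negb_or s3 -in_rim_ordS -SS -I2 s2 -I1.
Qed.

(** Three consecutive edges form a path, for n > 3 since some external edge is in J;
    it extends to a maximal one, which has at least as many edges. *)
Lemma run_connector (j i : nat) : s j -> ~~ [|| s i, s i.+1 | s i.+2] ->
  exists2 k, (1 < k)%N & exists C, connector J k C.
Proof.
move=> sj /norP[s0 /norP[s1 s2]].
have n4 : (3 < n)%N.
  rewrite ltnNge; apply/negP => n3; have {n3} En : n = 3%N by apply/eqP; rewrite eqn_leq n3.
  have : [|| j == i %[mod n], j == i.+1 %[mod n] | j == i.+2 %[mod n]]%N by rewrite En; lia.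
  rewrite -!(rim_eq hn) => /or3P[] /eqP E; move: sj s0 s1 s2; rewrite /in_rim E => ->//.
have rim_neq a b : (0 < b <= 3)%N -> (rim a == rim (a + b)) = false.
  move=> b3; apply/negbTE; rewrite rim_eq -[X in (X == _ %[mod _])%N]addn0 eqn_modDl mod0n.
  by rewrite modn_small; lia.
pose e k : edge (wheel hn) := inl (rim (i + k)).
pose v k : vert (wheel hn) := Some (rim (i + k)).
have e_ends k : ends (e k) = [set v k; v k.+1]%SET by rewrite /= -rimS -addnS.
pose P := [set x in [:: e 0; e 1; e 2]]%SET.
have e_neq a b : (0 < b <= 3)%N -> (rim (i + a) == rim (i + (a + b))) = false.
  by move=> b3; rewrite addnA rim_neq.
have P3 : #|P| = 3%N.
  rewrite cardsE; apply/card_uniqP; rewrite /= !inE !(inj_eq (@inl_inj _ _)).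
  by rewrite (e_neq 0 1)%N ?(e_neq 0 2)%N ?(e_neq 1 1)%N.
have P_path : is_path 3 P.
  exists (v 0), [:: (e 0, v 1); (e 1, v 2); (e 2, v 3)]%N; split=> //.
    by rewrite /= -!rimS -!addnS !eqxx.
  rewrite /= !inE !(inj_eq Some_inj).
  by rewrite (e_neq 0 1)%N ?(e_neq 0 2)%N ?(e_neq 0 3)%N ?(e_neq 1 1)%N ?(e_neq 1 2)%N ?(e_neq 2 1)%N.
have PF : P \subset (external_cycle hn :\: J)%SET.
  apply/fintype.subsetP => x; rewrite !inE => /or3P[] /eqP->; rewrite imset_f ?inE // andbT.
  - by rewrite /e addn0.
  - by rewrite /e addn1.
  - by rewrite /e addn2.
have [l [Q [PQ Q_max]]] := maximal_path_exists P_path PF.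
have l3 : (3 <= l)%N.
  have [Q_path _ _] := Q_max.
  by rewrite -P3 (leq_trans (subset_leq_card PQ)) ?card_is_path.
case: l l3 Q_max => // l l2 Q_max; exists l => //.
by eexists; exists Q; split; first exact: Q_max.
Qed.

Lemma external_cycleP : J = external_cycle hn <-> forall i, s i.
Proof.
split=> [-> i|sT]; first exact: imset_f.
apply/setP => -[i|i]; first by rewrite -[i]rim_val imset_f //; apply: sT.
rewrite -(rim_ord_pred hn i) spoke_in_J // !sT /=.
by apply/esym/negbTE/negP => /imsetP[].
Qed.

(** With two external edges in J, the pattern S N S, two spokes are in J as well,
    which makes four edges. *)
Lemma is_3cycleP (j : nat) : n = 3%N -> s j ->
  is_3cycle J <-> forall i, ~~ [&& s i, ~~ s i.+1 & s i.+2].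
Proof.
move=> En sj; have rim3 k : rim k.+3 = rim k.
  by have -> : k.+3 = (k + n)%N by [rewrite En addn3]; rewrite rim_addn.
have s3 k : s k.+3 = s k by rewrite /in_rim rim3.
have rim_neq01 k : (rim k == rim k.+1) = false by apply/negbTE; rewrite rim_eq En; lia.
have rim_neq02 k : (rim k == rim k.+2) = false by apply/negbTE; rewrite rim_eq En; lia.
have rim_neq10 k : (rim k.+1 == rim k) = false by rewrite eq_sym.
have rim_neq20 k : (rim k.+2 == rim k) = false by rewrite eq_sym.
have neqE := (rim_neq01, rim_neq02, rim_neq10, rim_neq20).
have spoke k : (inr (rim k) \in J) = s k.+2 (+) s k by rewrite -{1}rim3 spoke_in_J // s3.
split=> [[a [b [c [e1 [e2 [e3 [_ _ _ _ EJ]]]]]]] i|no101].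
  apply/negP => /and3P[s0 /negbTE s1 s2].
  have : (#|[set x in [:: inl (rim i); inl (rim i.+2); inr (rim i.+1); inr (rim i.+2)] : seq (edge (wheel hn))]%SET| <= #|J|)%N.
    apply: subset_leq_card; apply/fintype.subsetP => x; rewrite !inE => /or4P[] /eqP-> //.
      by rewrite spoke s3 s0 s1.
    by rewrite spoke s3 s1 s2.
  rewrite cardsE (card_uniqP _) /=; last by rewrite !inE !(inj_eq (@inl_inj _ _)) !(inj_eq (@inr_inj _ _)) !neqE.
  rewrite EJ; apply/negP; rewrite -ltnNge ltnS.
  rewrite cardsU cards2 cards1 (leq_trans (leq_subr _ _)) //.
  by case: (e1 != e2).
have cover (i : 'I_n) : [\/ i = rim j, i = rim j.+1 | i = rim j.+2].
  have : [|| i == j %[mod n], i == j.+1 %[mod n] | i == j.+2 %[mod n]]%N.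
    by move: (nat_of_ord i) => k; rewrite En; lia.
  by rewrite -!(rim_eq hn) rim_val => /or3P[] /eqP ->; [apply: Or31|apply: Or32|apply: Or33].
have ends_rim k : @ends (wheel hn) (inl (rim k)) = [set Some (rim k); Some (rim k.+1)]%SET.
  by rewrite /= -rimS.
have sp0 := spoke j; have sp1 := spoke j.+1; have sp2 := spoke j.+2.
rewrite !s3 in sp0 sp1 sp2.
have := no101 j; have := no101 j.+1; rewrite s3 sj /= andbT.
have [s1|s1] /= := boolP (s j.+1); have [s2|s2] //= := boolP (s j.+2); move=> _ _.
  exists (Some (rim j)), (Some (rim j.+1)), (Some (rim j.+2)), (inl (rim j)), (inl (rim j.+1)), (inl (rim j.+2)).
  split; rewrite ?ends_rim ?rim3 //.
    by rewrite /= !inE !(inj_eq Some_inj) !neqE.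
  apply/setP => -[i|i]; case: (cover i) => ->; rewrite !inE ?sp0 ?sp1 ?sp2 ?sj ?s1 ?s2 //;
    by rewrite !(inj_eq (@inl_inj _ _)) ?eqxx ?orbT //.
exists (Some (rim j)), (Some (rim j.+1)), None, (inl (rim j)), (inr (rim j.+1)), (inr (rim j)).
split; rewrite ?ends_rim //.
- by rewrite /= !inE !(inj_eq Some_inj) !neqE.
- by rewrite /= finset.setUC.
have m0 : (inl (rim j) \in J) = true by [].
have m1 : (inl (rim j.+1) \in J) = false by apply/negbTE.
have m2 : (inl (rim j.+2) \in J) = false by apply/negbTE.
apply/setP => -[i|i]; case: (cover i) => ->;
  rewrite !inE ?sp0 ?sp1 ?sp2 ?m0 ?m1 ?m2 ?sj ?(negbTE s1) ?(negbTE s2);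
  by rewrite ?(inj_eq (@inl_inj _ _)) ?(inj_eq (@inr_inj _ _)) ?neqE ?eqxx ?orbT.
Qed.

End Connectors.

(** * Wheels with circular flow number at least 5 *)

Lemma wheel_family_Phi_c (R : realType) (n : nat) (hn : (3 <= n)%N)
    (J : {set edge (wheel hn)}) (I : set (circ5 R)) (G : mgraph) :
  even_subgraph J -> SI5 I -> wheel_family J I G ->
  (5%:E <= Phi_c R G)%E <-> ~ solvable I n (in_rim J).
Proof.
move=> J_even hI [o [K [K_sigma G_iso]]].
by rewrite Phi_cP (isomorphic_modflow _ G_iso) (replace_modflow o K_sigma) wheel_modflow.
Qed.

Lemma nonempty_in_rim (n : nat) (hn : (3 <= n)%N) (J : {set edge (wheel hn)}) :
  even_subgraph J -> (exists e, e \in J) -> exists j, in_rim J j.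
Proof.
move=> J_even [[i|i] iJ]; first by exists i; rewrite /in_rim rim_val.
move: iJ; rewrite -(rim_ord_pred hn i) spoke_in_J //.
set k : nat := ord_pred i; have [sk _|_ sk] := boolP (in_rim J k).
  by exists k.
by exists k.+1.
Qed.

Local Close Scope quotient_scope.
Local Close Scope ring_scope.

Theorem theorem6p1 (R : realType) (n : nat) (hn : (3 <= n)%N)
    (J : {set edge (wheel hn)}) (J_nonempty : exists e, e \in J)
    (J_even : even_subgraph J)
    (I : set (circ5 R)) (hI : SI5 I)
    (G : mgraph) (hG : wheel_family J I G) :
  (5%:E <= Phi_c R G)%E <->
  [\/ I = set0,
      I = iarc 2 3,
      [/\ (I `<=` iarc 4 1)%classic, odd n
        & forall k : nat, (1 < k)%N -> ~ (exists C, connector J k C)]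
    | (I `<=` iarc 1 2 `|` iarc 3 4)%classic /\
      ([/\ (3 < n)%N, odd n & J = external_cycle hn] \/
       n = 3%N /\ is_3cycle J)].
Proof.
have [j sj] := nonempty_in_rim J_even J_nonempty.
rewrite (wheel_family_Phi_c J_even hI hG).
rewrite (not_solvableP hI hn (in_rim_addn J) sj).
have runs : (forall i, [|| in_rim J i, in_rim J i.+1 | in_rim J i.+2]) <->
    (forall k : nat, (1 < k)%N -> ~ (exists C, connector J k C)).
  split=> [run k k1 [C /(connector_run k1)[i]]|no_conn i]; first by rewrite run.
  by apply/negPn/negP => /(run_connector sj)[k k1] /(no_conn k k1).
have full := external_cycleP J_even.
have tri (n_eq3 : n = 3%N) := is_3cycleP J_even n_eq3 sj.
split=> [[E|E|[IA n_odd /runs H]|[IB [[n4 n_odd /full H]|[n_eq3 /(tri n_eq3) H]]]]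
        |[E|E|[IA n_odd /runs H]|[IB [[n4 n_odd /full H]|[n_eq3 /(tri n_eq3) H]]]]].
all: try by [apply: Or41|apply: Or42|apply: Or43].
all: by apply: Or44; split=> //; try (by left); right.
Qed.
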